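(* Let $\mathfrak{E},\mathfrak{H},\mathfrak{K}$ be Hilbert spaces and let $A\in\mathbf{B}(\mathfrak{E},\mathfrak{H})$ and $B\in\mathbf{B}(\mathfrak{E},\mathfrak{K})$. Let $B_{\rm reg}=(I-P)B$ and $B_{\rm sing}=PB$, where $P$ is the orthogonal projection from $\mathfrak{K}$ onto $\mathfrak{D}(A,B)^\perp$. Then the following statements are equivalent: (i) $B$ admits a unique Lebesgue type decomposition with respect to $A$; (ii) $L(A,B)$ admits a unique Lebesgue type decomposition; (iii) $\mathfrak{D}(A,B)$ is closed; (iv) $B_{\rm reg}$ is dominated by $A$; (v) the Radon-Nikodym derivative $R(A,B_{\rm reg})$ is a bounded operator. In this case, all Lebesgue type decompositions of $B$ with respect to $A$ coincide with the Lebesgue decomposition $B=B_{\rm reg}+B_{\rm sing}$.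
   Context: $\mathbf{B}(\mathfrak{X},\mathfrak{Y})$ denotes the everywhere defined bounded linear operators from the Hilbert space $\mathfrak{X}$ to the Hilbert space $\mathfrak{Y}$; $\mathbf{B}(\mathfrak{X})=\mathbf{B}(\mathfrak{X},\mathfrak{X})$. A linear relation $T$ from $\mathfrak{H}$ to $\mathfrak{K}$ is a linear subspace of $\mathfrak{H}\times\mathfrak{K}$, with elements written $\{f,g\}$; operators are identified with their graphs. $\operatorname{dom}T=\{f:\{f,g\}\in T\}$, $\operatorname{ran}T=\{g:\{f,g\}\in T\}$. $T^{**}$ is the closure of $T$ in $\mathfrak{H}\times\mathfrak{K}$. The sum of relations is $T_1+T_2=\{\{f,g_1+g_2\}:\{f,g_1\}\in T_1,\{f,g_2\}\in T_2\}$. A linear relation $T$ is regular if its closure $T^{**}$ is (the graph of) an operator; it is singular if its closure is a product of closed linear subspaces of $\mathfrak{H}$ and $\mathfrak{K}$. A Lebesgue type decomposition of a relation $T$ is a decomposition $T=T_1+T_2$ with $\operatorname{dom}T_1=\operatorname{dom}T_2=\operatorname{dom}T$, $\operatorname{ran}T_1\perp\operatorname{ran}T_2$, $T_1$ regular and $T_2$ singular. For $A\in\mathbf{B}(\mathfrak{E},\mathfrak{H})$, $B\in\mathbf{B}(\mathfrak{E},\mathfrak{K})$: $L(A,B)=\{\{Af,Bf\}: f\in\mathfrak{E}\}$, a linear relation from $\mathfrak{H}$ to $\mathfrak{K}$, and $\mathfrak{D}(A,B)=\{k\in\mathfrak{K}: B^*k\in\operatorname{ran}A^*\}$. $D\prec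 A$ ($D$ is dominated by $A$) means there is $c>0$ with $\|Df\|\le c\|Af\|$ for all $f\in\mathfrak{E}$. $B$ is almost dominated by $A$ if there exist Hilbert spaces $\mathfrak{K}_n$, operators $B_n\in\mathbf{B}(\mathfrak{E},\mathfrak{K}_n)$ and numbers $c_n\ge0$ such that for all $f\in\mathfrak{E}$: (a) $\|B_nf\|\le c_n\|Af\|$; (b) $\|B_nf\|\le\|B_{n+1}f\|$; (c) $\|B_nf\|\nearrow\|Bf\|$. $B$ is singular with respect to $A$ if for every $D\in\mathbf{B}(\mathfrak{E})$: $D\prec A$ and $D\prec B$ imply $D=0$. A Lebesgue type decomposition of $B$ with respect to $A$ is a decomposition $B=B_1+B_2$ with $B_1,B_2\in\mathbf{B}(\mathfrak{E},\mathfrak{K})$ such that $\operatorname{ran}B_1\perp\operatorname{ran}B_2$, $B_1$ is almost dominated by $A$, and $B_2$ is singular with respect to $A$. The operator $B_{\rm reg}$ is always almost dominated by $A$. If an operator $B$ is almost dominated by $A$, then $L(A,B)^{**}$ is (the graph of) a closed linear operator from $\mathfrak{H}$ to $\mathfrak{K}$ (not necessarily densely defined), and the Radon-Nikodym derivative of $B$ with respect to $A$ is $R(A,B)=L(A,B)^{**}$. *)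

(* Defs.v *)
From HB Require Import structures.
From mathcomp Require Import all_boot all_order all_algebra.
From mathcomp Require Import sesquilinear complex.
From mathcomp Require Import boolp classical_sets functions reals topology normedtype.
From mathcomp Require Import sequences.

Set Implicit Arguments.
Unset Strict Implicit.
Unset Printing Implicit Defensive.

Import Order.TTheory GRing.Theory Num.Theory.
Import numFieldNormedType.Exports.

Local Open Scope classical_set_scope.
Local Open Scope complex_scope.
Local Open Scope ring_scope.

(* Complex Hilbert spaces.  The norm of a normed module over R[i] takes its
   values in R[i]; an inequality x <= y in R[i] means that y - x is a
   nonnegative real, so a bound 0 < c or 0 <= c makes c real.  The
   inner product is linear in its first argument. *)
HB.mixin Record CompleteNormedModule_isHilbert (R : realType) H
    of CompleteNormedModule R[i] H := {
  inner : {dot H for (@Num.conj R[i])};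
  sqr_norm_inner : forall x : H, `|x| ^+ 2 = inner x x
}.

#[short(type="hilbertType")]
HB.structure Definition Hilbert (R : realType) :=
  {H of CompleteNormedModule R[i] H & CompleteNormedModule_isHilbert R H}.

Definition orthogonal_sets (R : realType) (X : hilbertType R) (S T : set X) :=
  forall x y, S x -> T y -> inner x y = 0.

Definition orthocompl (R : realType) (X : hilbertType R) (S : set X) : set X :=
  [set y | forall x, S x -> inner x y = 0].

(* For a closed linear subspace M, the set below is a singleton. *)
Definition orthoproj (R : realType) (X : hilbertType R) (M : set X) (x : X) : X :=
  xget 0 [set y | M y /\ orthocompl M (x - y)].

Definition bounded_operator (R : realType) (X Y : hilbertType R) (T : X -> Y) :=
  linear T /\ exists c : R[i], forall x, `|T x| <= c * `|x|.

(* For a bounded operator T, the set below is a singleton (Riesz). *)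
Definition adjoint (R : realType) (X Y : hilbertType R) (T : X -> Y) (y : Y) : X :=
  xget 0 [set x | forall z, inner (T z) y = inner z x].

Definition linear_subspace (R : realType) (V : lmodType R[i]) (S : set V) :=
  S 0 /\ forall (a : R[i]) u v, S u -> S v -> S (a *: u + v).

Section Relations.
Context {R : realType} {H K : hilbertType R}.
Implicit Types T : set (H * K).

Definition is_operator T := forall f g g', T (f, g) -> T (f, g') -> g = g'.

Definition is_bounded T :=
  exists c : R[i], forall f g, T (f, g) -> `|g| <= c * `|f|.

Definition rel_regular T := is_operator (closure T).

Definition rel_singular T :=
  exists (M : set H) (N : set K),
    [/\ linear_subspace M, closed M, linear_subspace N, closed N &
        closure T = M `*` N].

Definition rel_add T1 T2 : set (H * K) :=
  [set p | exists g1 g2, [/\ T1 (p.1, g1), T2 (p.1, g2) & p.2 = g1 + g2]].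

Definition rel_lebesgue_type T T1 T2 :=
  [/\ linear_subspace T1 /\ linear_subspace T2,
      T = rel_add T1 T2,
      T1.`1 = T.`1 /\ T2.`1 = T.`1,
      orthogonal_sets T1.`2 T2.`2 &
      rel_regular T1 /\ rel_singular T2].

End Relations.

Section Pairs.
Context {R : realType} {E H K : hilbertType R}.
Variables (A : E -> H) (B : E -> K).

Definition pair_relation : set (H * K) := range (fun f => (A f, B f)).

Definition pair_domain : set K := [set k | range (adjoint A) (adjoint B k)].

Definition dominated := exists2 c : R[i], 0 < c & forall f, `|B f| <= c * `|A f|.

(* R[i]^o gives R[i] its topology as a normed field. *)
Definition almost_dominated :=
  exists (K_ : nat -> hilbertType R) (B_ : forall n, E -> K_ n) (c : nat -> R[i]),
    [/\ forall n, bounded_operator (B_ n), forall n, 0 <= c n &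
    forall f, [/\ forall n, `|B_ n f| <= c n * `|A f|,
                  forall n, `|B_ n f| <= `|B_ n.+1 f| &
                  (fun n => `|B_ n f| : R[i]^o) @ \oo --> (`|B f| : R[i]^o)]].

Definition radon_nikodym : set (H * K) := closure pair_relation.

Definition reg_part (f : E) : K :=
  B f - orthoproj (orthocompl pair_domain) (B f).

Definition sing_part (f : E) : K := orthoproj (orthocompl pair_domain) (B f).

End Pairs.

Definition singular_wrt (R : realType) (E H K : hilbertType R)
    (A : E -> H) (B : E -> K) :=
  forall D : E -> E, bounded_operator D ->
    dominated A D -> dominated B D -> D = cst 0.

Definition lebesgue_type (R : realType) (E H K : hilbertType R)
    (A : E -> H) (B B1 B2 : E -> K) :=
  [/\ bounded_operator B1 /\ bounded_operator B2,
      B = B1 \+ B2,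
      orthogonal_sets (range B1) (range B2),
      almost_dominated A B1 &
      singular_wrt A B2].

(* Main.v *)
Require Import Defs.
From HB Require Import structures.
From mathcomp Require Import all_boot all_order all_algebra.
From mathcomp Require Import sesquilinear complex.
From mathcomp Require Import boolp classical_sets functions reals topology normedtype.
From mathcomp Require Import ring.

(** Let T be the relation L(A,B), and call (k, h) an adjoint pair when
    <Bf,k> = <Af,h> for all f.  Adjoint pairs are the elements of the adjoint
    relation, so the subspace D = D(A,B) consists of their first components, and
    the projection theorem in the Hilbert sum of H and K says that the closure of
    T is exactly the set of (h', g) with <g,k> = <h',h> for all adjoint pairs
    (k, h) ([closure_pair_relation]).  Both halves of a Lebesgue type
    decomposition can be read off adjoint pairs:

    - B is almost dominated by A iff the closure of T is an operator iff D has
      trivial orthocomplement.  The hard direction takes S = T T', with T' the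
      adjoint relation, a positive relation, and the bounded operators
      B_n = (1 + S/n^2)^-1 B.  They satisfy |B_n f| <= n |Af|, and since S is
      positive |B_n f| increases with n; they converge strongly to B.
    - B is singular with respect to A iff the closure of T is a product iff
      <Bf,k> = 0 for every k in D.  If some k violates this, f |-> <Bf,k> f0 is a
      nonzero operator dominated by A and by B.

    With these characterizations B = B_reg + B_sing is a Lebesgue type
    decomposition.  The map (B1, B2) |-> (L(A,B1), L(A,B2)) is a bijection from
    the decompositions of B to those of the relation
    ([rel_lebesgue_type_operators], [unique_lebesgue_rel]), which makes the two
    uniqueness statements equivalent.

    If D is not closed, pick x in the closure of D outside D and move the component
    of B_reg along x from the regular to the singular part: this is a second
    decomposition ([ando_decomposition]).  Conversely let D be closed and
    B = B1 + B2; the orthocomplement of ran B2 lies in the closure of D, hence in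
    D, and this forces ran B1 into D and ran B2 into its orthocomplement, so that
    B1 = B_reg ([closed_lebesgue_unique]).

    Finally, if D is closed then for every vector x the number
    |<x, B_reg f>| is at most a multiple of |Af|, and uniform boundedness
    turns this into |B_reg f| <= c |Af| ([closed_dominated]).  If B_reg is
    dominated by A, then for x in the closure of D the functional
    f |-> <Bf,x> = <B_reg f,x> factors through A by the Riesz theorem, so x is in D
    ([dominated_closed]).  The bound on B_reg passes to the closure of its graph
    relation, which is the Radon-Nikodym derivative. *)

Set Implicit Arguments.
Unset Strict Implicit.
Unset Printing Implicit Defensive.

Import Order.TTheory GRing.Theory Num.Theory.
Import numFieldNormedType.Exports.

Local Open Scope classical_set_scope.
Local Open Scope ring_scope.
Local Notation "R [i]" := (complex R) (at level 1, left associativity, format "R [i]").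

(** * Near-minimizers of a positive definite form *)

Section DotForms.
Context {R : realType} {V : lmodType R[i]} (form : {dot V for (@Num.conj R[i])}).
Local Notation "''[' u , v ]" := (form u v) : ring_scope.
Local Notation "''[' u ]" := (form u u) : ring_scope.

Lemma dotC u v : '[u, v] = ('[v, u])^*.
Proof. by rewrite hermC expr0 mul1r. Qed.

Lemma dot_ge0 u : 0 <= '[u].
Proof.
have [->|u0] := eqVneq u 0; first by rewrite linear0l.
exact/ltW/neq0_dnorm_gt0.
Qed.

Lemma dot_eq0 u : '[u] = 0 -> u = 0.
Proof. by apply: contra_eq => u0; rewrite gt_eqF ?neq0_dnorm_gt0. Qed.

(** Removing from u its component along v costs exactly that component; the
    Cauchy-Schwarz inequality and the variational characterization of
    projections both come from this identity. *)
Lemma dot_sub_component u v : v != 0 ->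
  '[u - ('[u, v] / '[v]) *: v] = '[u] - `|'[u, v]| ^+ 2 / '[v].
Proof.
move=> v0.
have vv : '[v] != 0 by rewrite gt_eqF ?neq0_dnorm_gt0.
set a := _ / _.
have orth : '[u - a *: v, v] = 0.
  by rewrite linearBl/= linearZl_LR/= divfK ?subrr.
rewrite linearBr/= linearZr_LR/= orth mulr0 subr0 linearBl/= linearZl_LR/=.
by congr (_ - _); rewrite (dotC v) normCK mulrAC.
Qed.

Lemma dot_CauchySchwarz u v : `|'[u, v]| ^+ 2 <= '[u] * '[v].
Proof.
have [->|v0] := eqVneq v 0; first by rewrite !linear0r normr0 expr0n mulr0.
have := dot_ge0 (u - ('[u, v] / '[v]) *: v).
by rewrite dot_sub_component// subr_ge0 ler_pdivrMr ?neq0_dnorm_gt0.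
Qed.

Lemma dot_pyth u v : '[u, v] = 0 -> '[u + v] = '[u] + '[v].
Proof.
move=> uv; rewrite linearDl/= !linearDr/= uv (dotC v) uv rmorph0.
by rewrite addr0 add0r.
Qed.

Lemma dot_parallelogram p u v :
  '[u - v] = 2 * '[p - u] + 2 * '[p - v] - 4 * '[p - 2^-1 *: (u + v)].
Proof.
have -> : u - v = (p - v) - (p - u) by rewrite opprB [RHS]addrC addrA subrK.
have -> : p - 2^-1 *: (u + v) = 2^-1 *: ((p - u) + (p - v)).
  rewrite [(p - u) + _]addrACA -opprD scalerBr; congr (_ - _).
  by rewrite -mulr2n -(scaler_nat 2 p) scalerA mulVf ?scale1r ?pnatr_eq0.
move: (p - u) (p - v) => a b.
rewrite linearZl_LR/= linearZr_LR/= fmorphV rmorph_nat.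
rewrite linearBl/= !linearBr/= linearDl/= !linearDr/=.
by field.
Qed.

(** Near-minimizers replace exact nearest points: they exist without
    completeness, and the limit is taken only afterwards, in the two complete
    factors of a product separately. *)
Lemma dot_near_minimizer (T : set V) p (e : R[i]) : T 0 -> 0 < e ->
  exists2 t, T t & forall s, T s -> '[p - t] <= '[p - s] + e.
Proof.
move=> T0 e0.
pose S : set R := [set complex.Re '[p - t] | t in T].
have ge0Re (z : R[i]) : 0 <= z -> 0 <= complex.Re z.
  by rewrite lecE => /andP[].
have hinf : has_inf S.
  split; first by exists (complex.Re '[p - 0]); exists 0.
  by exists 0 => _ [t _ <-]; exact/ge0Re/dot_ge0.
have eE : e = (complex.Re e)%:C%C by rewrite RRe_real// gtr0_real.
have e0' : 0 < complex.Re e by move: e0; rewrite ltcE => /andP[].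
have [_ [t Tt <-] lt] := inf_adherent e0' hinf.
exists t => // s Ts.
rewrite -[X in X <= _]RRe_real ?ger0_real ?dot_ge0//.
rewrite -['[p - s]]RRe_real ?ger0_real ?dot_ge0// eE -rmorphD/= lecR.
apply/ltW/(lt_le_trans lt); rewrite lerD2r; apply: ge_inf; first by case: hinf.
by exists s.
Qed.

(** Otherwise subtracting the component along s would improve the distance by
    more than e. *)
Lemma dot_near_minimizer_orth (T : set V) p t (e : R[i]) :
  linear_subspace T -> T t -> (forall s, T s -> '[p - t] <= '[p - s] + e) ->
  forall s, T s -> `|'[p - t, s]| ^+ 2 <= e * '[s].
Proof.
move=> [T0 TD] Tt mint s Ts.
have [->|s0] := eqVneq s 0; first by rewrite !linear0r normr0 expr0n mulr0.
have Tts : T (('[p - t, s] / '[s]) *: s + t) by exact: TD.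
have := mint _ Tts; rewrite opprD addrA addrAC dot_sub_component// addrAC.
by rewrite -addrA lerDl subr_ge0 ler_pdivrMr ?neq0_dnorm_gt0.
Qed.

(** By the parallelogram law, since the midpoint of t and u is no closer to p
    than either of them up to e and d. *)
Lemma dot_near_minimizer_close (T : set V) p t u (e d : R[i]) :
  linear_subspace T -> T t -> T u ->
  (forall s, T s -> '[p - t] <= '[p - s] + e) ->
  (forall s, T s -> '[p - u] <= '[p - s] + d) ->
  '[t - u] <= 2 * (e + d).
Proof.
move=> [T0 TD] Tt Tu mint minu.
have Tm : T (2^-1 *: (t + u)).
  rewrite scalerDr; apply: (TD) => //; rewrite -[_ *: u]addr0; exact: TD.
rewrite (dot_parallelogram p) lerBlDr.
have -> : 4 = 2 + 2 :> R[i] by rewrite -natrD.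
have twoP x y z : x <= y + z -> 2 * x <= 2 * z + 2 * y :> R[i].
  by move=> h; rewrite addrC -mulrDr ler_pM2l ?ltr0n.
rewrite [2 * (e + d)]mulrDr [(2 + 2) * _]mulrDl [leRHS]addrACA.
by apply: lerD; apply: twoP; [exact: mint|exact: minu].
Qed.

End DotForms.

(** * Inner products, norms and limits in a complex Hilbert space *)

Section Hilbert.
Context {R : realType}.
Implicit Types X Y H K : hilbertType R.

Lemma innerC X (x y : X) : inner x y = (inner y x)^*.
Proof. exact: dotC. Qed.
Lemma innerDl X (x y z : X) : inner (x + y) z = inner x z + inner y z.
Proof. by rewrite linearDl. Qed.
Lemma innerDr X (x y z : X) : inner z (x + y) = inner z x + inner z y.
Proof. by rewrite linearDr. Qed.
Lemma innerNl X (x y : X) : inner (- x) y = - inner x y.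
Proof. by rewrite linearNl. Qed.
Lemma innerNr X (x y : X) : inner x (- y) = - inner x y.
Proof. by rewrite linearNr. Qed.
Lemma innerBl X (x y z : X) : inner (x - y) z = inner x z - inner y z.
Proof. by rewrite linearBl. Qed.
Lemma innerBr X (x y z : X) : inner z (x - y) = inner z x - inner z y.
Proof. by rewrite linearBr. Qed.
Lemma innerZl X a (x y : X) : inner (a *: x) y = a * inner x y.
Proof. by rewrite linearZl_LR. Qed.
Lemma innerZr X a (x y : X) : inner x (a *: y) = a^* * inner x y.
Proof. by rewrite linearZr_LR. Qed.
Lemma inner0l X (x : X) : inner 0 x = 0.
Proof. by rewrite linear0l. Qed.
Lemma inner0r X (x : X) : inner x 0 = 0.
Proof. by rewrite linear0r. Qed.
Lemma inner_eq0C X (x y : X) : inner x y = 0 -> inner y x = 0.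
Proof. by move=> xy; rewrite innerC xy rmorph0. Qed.
Lemma inner_ge0 X (x : X) : 0 <= inner x x.
Proof. exact: dot_ge0. Qed.
Lemma inner_eq0 X (x : X) : inner x x = 0 -> x = 0.
Proof. exact: dot_eq0. Qed.

Lemma inner_inj X (x y : X) : (forall z, inner z x = inner z y) -> x = y.
Proof.
move=> xy; apply/eqP; rewrite -subr_eq0; apply/eqP/inner_eq0.
by rewrite innerBr xy subrr.
Qed.

Lemma norm_inner X (x y : X) : `|inner x y| <= `|x| * `|y|.
Proof.
rewrite -(@ler_pXn2r _ 2) ?nnegrE ?mulr_ge0// exprMn !sqr_norm_inner.
exact: dot_CauchySchwarz.
Qed.

Lemma sqr_norm_le X Y (x : X) (y : Y) (c : R[i]) : 0 <= c ->
  inner x x <= c ^+ 2 * inner y y -> `|x| <= c * `|y|.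
Proof.
move=> c0 h.
by rewrite -(@ler_pXn2r _ 2) ?nnegrE ?mulr_ge0// exprMn !sqr_norm_inner.
Qed.

Lemma inner_le_add X (u v : X) : 0 <= inner v u ->
  inner u u <= inner (u + v) (u + v).
Proof.
move=> vu; have uv : 0 <= inner u v by rewrite innerC conjC_ge0.
by rewrite innerDl !innerDr -addrA lerDl !addr_ge0 ?inner_ge0.
Qed.

Lemma orthogonal_summands_le X (x y : X) : inner x y = 0 ->
  `|x| <= `|x + y| /\ `|y| <= `|x + y|.
Proof.
move=> xy; rewrite -[leRHS]mul1r -[X in _ /\ _ <= X]mul1r.
by split; apply: sqr_norm_le => //; rewrite expr1n mul1r dot_pyth// ?lerDl ?lerDr inner_ge0.
Qed.

(** The order of R[i] is partial, but a positive complex number is a positive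
    real, so the archimedean property of R applies. *)
Lemma small_invn (e : R[i]) : 0 < e -> exists n, n.+1%:R^-1 < e :> R[i].
Proof.
move=> e0.
have eE : e = (complex.Re e)%:C%C by rewrite RRe_real// gtr0_real.
have e0' : 0 < complex.Re e by move: e0; rewrite ltcE => /andP[].
exists (Num.truncn (complex.Re e)^-1).
rewrite eE -[_.+1%:R](rmorph_nat (real_complex R)) -fmorphV ltcR.
by rewrite -ltf_pV2 ?(posrE,invr_gt0)// invrK truncnS_gt.
Qed.

Lemma invn_le m n : (m <= n)%N -> n.+1%:R^-1 <= m.+1%:R^-1 :> R[i].
Proof. by move=> mn; rewrite lef_pV2 ?posrE ?ltr0n// ler_nat. Qed.

Lemma closure_normP (V : normedModType R[i]) (S : set V) x :
  closure S x <-> forall e : R[i], 0 < e -> exists2 s, S s & `|x - s| < e.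
Proof.
split=> [clS e e0|h B].
  have [s [Ss]] := clS _ (nbhsx_ballx x e e0).
  by rewrite -ball_normE; exists s.
move=> /nbhs_ballP[e /= e0 eB]; have [s Ss xs] := h _ e0.
by exists s; split => //; apply: eB; rewrite -ball_normE.
Qed.

Lemma closure_pairP H K (S : set (H * K)) p :
  closure S p <-> forall e : R[i], 0 < e ->
    exists2 s, S s & `|p.1 - s.1| < e /\ `|p.2 - s.2| < e.
Proof.
split=> [clS e e0|h B].
  have [s [Ss]] := clS _ (nbhsx_ballx p e e0).
  by case=> /=; rewrite -!ball_normE; exists s.
move=> /nbhs_ballP[e /= e0 eB]; have [s Ss [xs ys]] := h _ e0.
by exists s; split => //; apply: eB; split; rewrite -ball_normE.
Qed.

(** Completeness, in the quantitative form that the minimizing sequences and the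
    gliding hump provide. *)
Lemma cauchy_seq_limit X (u : nat -> X) (c : R[i]) :
  0 < c -> (forall m n, (m <= n)%N -> `|u m - u n| ^+ 2 <= c * m.+1%:R^-1) ->
  exists x, forall e : R[i], 0 < e ->
    exists N, forall n, (N <= n)%N -> `|x - u n| < e.
Proof.
move=> c0 cau.
have : cvg (u @ \oo).
  apply/cauchy_cvgP/cauchy_exP => e e0.
  have [N hN] : exists N, N.+1%:R^-1 < e ^+ 2 / c.
    by apply: small_invn; rewrite divr_gt0 ?exprn_gt0.
  exists (u N); exists N => // n /= Nn.
  rewrite -ball_normE /=.
  rewrite -(@ltr_pXn2r _ 2) ?nnegrE ?(ltW e0)//.
  by apply: (le_lt_trans (cau _ _ Nn)); rewrite mulrC -ltr_pdivlMr.
move=> /cvg_ex[x /cvgrPdist_lt ux]; exists x => e e0.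
by have [N _ hN] := ux _ e0; exists N.
Qed.

End Hilbert.

(** * The projection theorem in a Hilbert sum *)

Section ProductForm.
Context {R : realType} (H K : hilbertType R).

(** The inner product of the Hilbert sum, kept as a bare form because H * K carries
    the maximum norm; the two norms define the same topology. *)
Definition pair_inner (p q : H * K) : R[i] := inner p.1 q.1 + inner p.2 q.2.

Let pair_inner_bilinear : bilinear_for
  (GRing.Scale.Law.clone _ _ *%R _)
  (GRing.Scale.Law.clone _ _ (@Num.conj R[i] \; *%R) _) pair_inner.
Proof.
split=> [p a x y|p a x y] /=; rewrite /pair_inner /=.
  by rewrite !innerDl !innerZl mulrDr addrACA.
by rewrite !innerDr !innerZr mulrDr addrACA.
Qed.

HB.instance Definition _ := bilinear_isBilinear.Build R[i] (H * K)%type (H * K)%type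
  R[i] _ _ pair_inner pair_inner_bilinear.

Let pair_inner_hermitian p q :
  pair_inner p q = (-1) ^+ false * (pair_inner q p)^*.
Proof.
by rewrite expr0 mul1r /pair_inner rmorphD/= -!innerC.
Qed.

HB.instance Definition _ := isHermitianSesquilinear.Build R[i] (H * K)%type
  false (@Num.conj R[i]) pair_inner pair_inner_hermitian.

Let pair_inner_gt0 p : p != 0 -> 0 < pair_inner p p.
Proof.
move=> p0; rewrite lt0r addr_ge0 ?inner_ge0// andbT.
apply: contra p0; rewrite paddr_eq0 ?inner_ge0// => /andP[/eqP/inner_eq0 p1 /eqP/inner_eq0 p2].
by apply/eqP; case: p p1 p2 => /= x y -> ->.
Qed.

HB.instance Definition _ := isDotProduct.Build R[i] (H * K)%type pair_inner pair_inner_gt0.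

End ProductForm.

Section Projection.
Context {R : realType}.
Implicit Types X H K : hilbertType R.

(** The limit q of a sequence of near-minimizers of the distance from p to T:
    the sequence is Cauchy in each factor, and its residuals are orthogonal to T
    up to an error tending to 0. *)
Theorem closure_projection H K (T : set (H * K)) (p : H * K) :
  linear_subspace T -> exists2 q, closure T q &
    forall s, T s -> inner (p.1 - q.1) s.1 + inner (p.2 - q.2) s.2 = 0.
Proof.
move=> Tlin; have [T0 TD] := Tlin.
have ex n : exists t, T t /\ forall s, T s ->
    pair_inner (p - t) (p - t) <= pair_inner (p - s) (p - s) + n.+1%:R^-1.
  have [|t Tt tmin] := @dot_near_minimizer R _ (@pair_inner R H K) T p n.+1%:R^-1 T0.
    by rewrite invr_gt0 ltr0n.
  by exists t.
have [t tP] := choice ex.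
have tcau m n : (m <= n)%N ->
    pair_inner (t m - t n) (t m - t n) <= 4 * m.+1%:R^-1.
  move=> mn; have [Tm minm] := tP m; have [Tn minn] := tP n.
  apply: (le_trans (dot_near_minimizer_close Tlin Tm Tn minm minn)).
  have -> : 4 = 2 * 2 :> R[i] by rewrite -natrM.
  rewrite -mulrA ler_pM2l ?ltr0n// [leRHS]mulr_natl [leRHS]mulr2n lerD2l.
  exact: invn_le.
have C4 : 0 < 4 :> R[i] by rewrite ltr0n.
have [x xP] : exists x, forall e : R[i], 0 < e ->
    exists N, forall n, (N <= n)%N -> `|x - (t n).1| < e.
  apply: (cauchy_seq_limit C4) => m n mn; rewrite sqr_norm_inner.
  by apply: le_trans (tcau _ _ mn); rewrite lerDl inner_ge0.
have [y yP] : exists y, forall e : R[i], 0 < e ->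
    exists N, forall n, (N <= n)%N -> `|y - (t n).2| < e.
  apply: (cauchy_seq_limit C4) => m n mn; rewrite sqr_norm_inner.
  by apply: le_trans (tcau _ _ mn); rewrite lerDr inner_ge0.
exists (x, y).
  apply/closure_pairP => e e0; have [[M MP] [N NP]] := (xP _ e0, yP _ e0).
  exists (t (maxn M N)); first by have [] := tP (maxn M N).
  by split; [apply: MP; rewrite leq_maxl|apply: NP; rewrite leq_maxr].
move=> s Ts.
have small n : `|pair_inner (p - t n) s| ^+ 2 <= n.+1%:R^-1 * pair_inner s s.
  have [Tn minn] := tP n.
  exact: (dot_near_minimizer_orth Tlin Tn minn Ts).
have ss0 : 0 <= pair_inner s s by exact: dot_ge0.
set d := pair_inner s s in small ss0.
(* <p - q, s> differs from <p - t_n, s> by the errors of t_n in the two factors,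
   which cost e' |s.1| and e' |s.2|; the residual at t_n costs e' (1 + d).  The
   summand 1 keeps c positive and gives d <= (1 + d)^2. *)
set c := `|s.1| + `|s.2| + (1 + d).
have c0 : 0 < c by rewrite ltr_wpDl ?addr_ge0// ltr_wpDr.
apply/eqP; rewrite -normr_le0; apply/ler_addgt0Pl => e e0; rewrite addr0.
pose e' := e / c; have e'0 : 0 < e' by rewrite divr_gt0.
have [M MP] := xP _ e'0; have [N NP] := yP _ e'0.
have [k kP] := small_invn (exprn_gt0 2 e'0).
pose n := maxn k (maxn M N).
have -> : inner (p.1 - (x, y).1) s.1 + inner (p.2 - (x, y).2) s.2 =
    pair_inner (p - t n) s - (inner (x - (t n).1) s.1 + inner (y - (t n).2) s.2).
  by rewrite /pair_inner /= !innerBl; ring.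
have cE : e = e' * `|s.1| + e' * `|s.2| + e' * (1 + d).
  by rewrite -!mulrDr -/c divfK ?gt_eqF.
rewrite [leRHS]cE [leRHS]addrC.
apply: (le_trans (ler_normB _ _)); apply: lerD; last first.
  apply: (le_trans (ler_normD _ _)); apply: lerD;
    apply: (le_trans (norm_inner _ _)); apply: ler_wpM2r => //; apply: ltW.
    by apply: MP; rewrite !leq_max leqnn orbT.
  by apply: NP; rewrite !leq_max leqnn !orbT.
have ed0 : 0 <= e' * (1 + d) by rewrite mulr_ge0 ?(ltW e'0)// addr_ge0.
rewrite -(@ler_pXn2r _ 2) ?nnegrE//.
apply: (le_trans (small n)); rewrite exprMn.
apply: ler_pM => //.
- by rewrite invr_ge0 ler0n.
- by apply: (le_trans (invn_le _)) (ltW kP); rewrite leq_maxl.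
- rewrite sqrrD expr1n mul1r -addrA -{1}[d]add0r lerD// mulr2n -addrA lerDl.
  by rewrite addr_ge0 ?exprn_ge0.
Qed.

End Projection.

(** * Linear maps and subspaces *)

Section LinearMaps.
Context {R : realType} {X Y : lmodType R[i]} (T : X -> Y) (Tlin : linear T).

Lemma linear_mapD u v : T (u + v) = T u + T v.
Proof. by have := Tlin 1 u v; rewrite !scale1r. Qed.

Lemma linear_map0 : T 0 = 0.
Proof. by apply: (@addrI _ (T 0)); rewrite -linear_mapD !addr0. Qed.

Lemma linear_mapZ a u : T (a *: u) = a *: T u.
Proof. by have := Tlin a u 0; rewrite linear_map0 !addr0. Qed.

Lemma linear_mapB u v : T (u - v) = T u - T v.
Proof. by rewrite linear_mapD -scaleN1r linear_mapZ scaleN1r. Qed.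

End LinearMaps.

Section Subspaces.
Context {R : realType} {V : lmodType R[i]} (S : set V) (Slin : linear_subspace S).

Lemma subspaceD u v : S u -> S v -> S (u + v).
Proof. by move=> Su Sv; rewrite -[u]scale1r; apply: Slin.2. Qed.

Lemma subspaceZ a u : S u -> S (a *: u).
Proof. by move=> Su; rewrite -[_ *: _]addr0; apply: Slin.2 => //; exact: Slin.1. Qed.

Lemma subspaceB u v : S u -> S v -> S (u - v).
Proof. by move=> Su Sv; apply: subspaceD => //; rewrite -scaleN1r; exact: subspaceZ. Qed.

End Subspaces.

(** Bounds c are arbitrary complex numbers; this replaces them by their modulus. *)
Lemma le_norm_mul (R : realType) (c r : R[i]) : 0 <= r -> 0 <= c * r ->
  c * r <= `|c| * r.
Proof. by move=> r0 cr0; rewrite -[leLHS]ger0_norm// normrM (ger0_norm r0). Qed.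

(** * Orthocomplements and orthogonal projections *)

Section Orthogonality.
Context {R : realType} {X : hilbertType R}.
Implicit Types S M : set X.

Lemma orthocompl_subspace S : linear_subspace (orthocompl S).
Proof.
split=> [x _|a u v Su Sv x Sx]; first by rewrite inner0r.
by rewrite innerDr innerZr Su// Sv// mulr0 addr0.
Qed.

Lemma orthocompl_anti S M : S `<=` M -> orthocompl M `<=` orthocompl S.
Proof. by move=> SM y My x /SM; exact: My. Qed.

Lemma orthocompl_double S : S `<=` orthocompl (orthocompl S).
Proof. by move=> x Sx y Sy; exact/inner_eq0C/Sy. Qed.

Lemma orthocompl_self S x : S x -> orthocompl S x -> x = 0.
Proof. by move=> Sx /(_ _ Sx)/inner_eq0. Qed.

Lemma orthocompl_closure S x y : closure S x -> orthocompl S y -> inner x y = 0.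
Proof.
move=> /closure_normP clx Sy; apply/eqP; rewrite -normr_le0.
apply/ler_addgt0Pl => e e0; rewrite addr0.
have c0 : 0 < `|y| + 1 by rewrite ltr_wpDl.
have [s Ss /ltW xs] := clx _ (divr_gt0 e0 c0).
rewrite -[inner x y]subr0 -(Sy _ Ss) -innerBl.
apply: (le_trans (norm_inner _ _)); apply: (le_trans (ler_wpM2r _ xs)) => //.
by rewrite mulrAC ler_pdivrMr// ler_wpM2l ?(ltW e0)// lerDl.
Qed.

(** Embed M in the Hilbert sum of two copies of X as the pairs (m, 0). *)
Theorem projection_closure M x : linear_subspace M ->
  exists2 y, closure M y & orthocompl M (x - y).
Proof.
move=> Mlin; pose T : set (X * X) := [set p | M p.1 /\ p.2 = 0].
have Tlin : linear_subspace T.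
  split; first by split => //; exact: Mlin.1.
  move=> a u v [Mu u2] [Mv v2]; split; first exact: Mlin.2.
  by rewrite /= u2 v2 scaler0 addr0.
have [[y1 y2] /closure_pairP cly orth] := closure_projection (x, 0) Tlin.
exists y1.
  by apply/closure_normP => e /cly[s [Ms _] [xs _]]; exists s.1.
move=> m Mm; apply: inner_eq0C.
by have := orth (m, 0) (conj Mm erefl); rewrite /= inner0r addr0.
Qed.

Lemma orthocompl_decomposition M x : linear_subspace M ->
  exists2 y, orthocompl M y & orthocompl (orthocompl M) (x - y).
Proof.
move=> Mlin; have [z clz oz] := projection_closure x Mlin.
exists (x - z) => // u Mu; rewrite opprB addrC subrK.
exact/inner_eq0C/(orthocompl_closure clz).
Qed.

Lemma orthocompl_double_closed M : linear_subspace M ->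
  closed M <-> orthocompl (orthocompl M) `<=` M.
Proof.
move=> Mlin; split=> [Mcl x ddx|sub].
  have [y /Mcl My oy] := projection_closure x Mlin.
  suff /eqP : x - y = 0 by rewrite subr_eq0 => /eqP ->.
  apply: (orthocompl_self oy).
  by apply: (subspaceB (orthocompl_subspace (orthocompl M))) => //; exact: orthocompl_double.
by move=> x clx; apply: sub => y My; exact/inner_eq0C/(orthocompl_closure clx).
Qed.

Lemma orthocompl_closed S : closed (orthocompl S).
Proof.
apply/(orthocompl_double_closed (orthocompl_subspace S)).
exact/orthocompl_anti/orthocompl_double.
Qed.

Lemma orthoproj_eq M x y : linear_subspace M -> M y -> orthocompl M (x - y) ->
  orthoproj M x = y.
Proof.
move=> Mlin My oy; rewrite /orthoproj.
have /xgetPex : exists z, [set z | M z /\ orthocompl M (x - z)] z by exists y.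
move=> /(_ 0) []; set z := xget _ _ => Mz oz; apply/eqP; rewrite -subr_eq0; apply/eqP.
apply: (@orthocompl_self M); first exact: (subspaceB Mlin).
rewrite (_ : z - y = (x - y) - (x - z)); last by rewrite opprB [RHS]addrC addrA subrK.
by apply: (subspaceB (orthocompl_subspace M)).
Qed.

Lemma orthoproj_orthocompl M x : linear_subspace M ->
  orthocompl M (orthoproj (orthocompl M) x) /\
  orthocompl (orthocompl M) (x - orthoproj (orthocompl M) x).
Proof.
move=> Mlin; have [y oy ooy] := orthocompl_decomposition x Mlin.
by rewrite (orthoproj_eq (orthocompl_subspace _) oy ooy).
Qed.

End Orthogonality.

(** * The Riesz theorem, factorization and adjoints *)

Section Riesz.
Context {R : realType}.
Implicit Types X Y E H K : hilbertType R.

(** A functional bounded by |Af| is represented by a vector of H: take f0 with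
    phi f0 = 1 and the part z of A f0 orthogonal to the image of the kernel of
    phi; z is nonzero by the bound, and a multiple of it represents phi.  For
    A the identity this is the Riesz theorem; applied to f |-> <Cf,g> it is the
    factorization half of the Douglas lemma. *)
Lemma functional_factor E H (A : E -> H) (phi : E -> R[i]) (c : R[i]) :
  linear A -> (forall a u v, phi (a *: u + v) = a * phi u + phi v) ->
  (forall f, `|phi f| <= c * `|A f|) -> exists h, forall f, phi f = inner (A f) h.
Proof.
move=> Alin philin phiA.
have [phi0|] := pselect (forall f, phi f = 0).
  by exists 0 => f; rewrite inner0r phi0.
move=> /existsNP[f1 /eqP f1n].
have phi0 : phi 0 = 0.
  apply: (@addrI _ (phi 0)); rewrite addr0.
  by have := philin 1 0 0; rewrite scale1r addr0 mul1r.
have phiZ a u : phi (a *: u) = a * phi u.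
  by have := philin a u 0; rewrite phi0 !addr0.
have phiB u v : phi (u - v) = phi u - phi v.
  by have := philin (- 1) v u; rewrite scaleN1r mulN1r addrC => ->; rewrite addrC.
pose f0 := (phi f1)^-1 *: f1.
have phif0 : phi f0 = 1 by rewrite phiZ mulVf.
pose N : set H := [set A f | f in [set f | phi f = 0]].
have Nlin : linear_subspace N.
  split; first by exists 0 => //; exact: linear_map0.
  move=> a _ _ [u /= u0 <-] [v /= v0 <-]; exists (a *: u + v) => //=.
    by rewrite philin u0 v0 mulr0 addr0.
  by rewrite Alin.
have [q clq oq] := projection_closure (A f0) Nlin.
set z := A f0 - q in oq.
have z0 : z != 0.
  apply/eqP => /eqP; rewrite subr_eq0 => /eqP qE.
  have c0 : 0 < `|c| + 1 by rewrite ltr_wpDl.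
  have d0 : 0 < (`|c| + 1)^-1 by rewrite invr_gt0.
  move: clq => /closure_normP/(_ _ d0)[_ [f /= f00 <-]].
  rewrite -qE -linear_mapB// => lt.
  have := phiA (f0 - f); rewrite phiB f00 subr0 phif0 normr1 => le1.
  have : `|c| * `|A (f0 - f)| < 1.
    rewrite -(mulfV (lt0r_neq0 c0)).
    have : `|c| * `|A (f0 - f)| <= (`|c| + 1) * `|A (f0 - f)|.
      by apply: ler_wpM2r => //; rewrite lerDl.
    by move=> /le_lt_trans; apply; rewrite ltr_pM2l.
  apply/negP; rewrite -real_leNgt ?realM// ?normr_real//.
  by apply: (le_trans le1); apply: le_norm_mul => //; apply: le_trans le1.
have zz : inner z z != 0 by apply: contra z0 => /eqP/inner_eq0/eqP.
have A0z : inner (A f0) z = inner z z.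
  by rewrite {2}/z innerBl (orthocompl_closure clq oq) subr0.
exists ((inner z z)^-1 *: z) => f.
rewrite innerZr fmorphV [X in X^-1 * _](_ : _ = inner z z); last exact/esym/innerC.
have : inner (A (f - phi f *: f0)) z = 0.
  by apply: oq; exists (f - phi f *: f0) => //=; rewrite phiB phiZ phif0 mulr1 subrr.
rewrite (linear_mapB Alin) (linear_mapZ Alin) innerBl innerZl A0z => /eqP.
by rewrite subr_eq0 => /eqP ->; rewrite mulrC mulfK.
Qed.

Lemma adjointP X Y (T : X -> Y) y : bounded_operator T ->
  forall x, inner (T x) y = inner x (adjoint T y).
Proof.
move=> [Tlin [c Tc]].
have [h hP] : exists h, forall x, inner (T x) y = inner x h.
  apply: (@functional_factor X X id (fun x => inner (T x) y) (`|c| * `|y|)) => //.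
    by move=> a u v; rewrite Tlin innerDl innerZl.
  move=> x; apply: (le_trans (norm_inner _ _)); rewrite mulrAC ler_wpM2r//.
  by apply: (le_trans (Tc x)); apply: le_norm_mul => //; exact: le_trans (Tc x).
have := @xgetPex _ 0 [set x | forall z, inner (T z) y = inner z x].
by apply; exists h.
Qed.

End Riesz.

(** * The adjoint relation of a pair of operators *)

Section PairAdjoint.
Context {R : realType} {E H K : hilbertType R}.
Variables (A : E -> H) (B : E -> K).

(** The graph of the adjoint relation of L(A,B). *)
Definition pair_adjoint k h := forall f, inner (B f) k = inner (A f) h.

(** By [adjointP] the adjoints of A and B satisfy their defining equations, so the
    adjoint of B at k is in the range of the adjoint of A iff some h completes k to
    an adjoint pair. *)
Lemma pair_domainP k : bounded_operator A -> bounded_operator B ->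
  pair_domain A B k <-> exists h, pair_adjoint k h.
Proof.
move=> Abd Bbd; split=> [[h _ AB]|[h AB]]; exists h => //.
  by move=> f; rewrite adjointP// -AB -adjointP.
by apply: inner_inj => f; rewrite -!adjointP.
Qed.

Lemma pair_adjointD a k h k' h' : pair_adjoint k h -> pair_adjoint k' h' ->
  pair_adjoint (a *: k + k') (a *: h + h').
Proof. by move=> kh kh' f; rewrite !innerDr !innerZr kh kh'. Qed.

Lemma pair_adjoint0 : pair_adjoint 0 0.
Proof. by move=> f; rewrite !inner0r. Qed.

Lemma pair_domain_subspace : bounded_operator A -> bounded_operator B ->
  linear_subspace (pair_domain A B).
Proof.
move=> Abd Bbd; split; first by apply/pair_domainP => //; exists 0; exact: pair_adjoint0.
move=> a u v /pair_domainP[//|//|h uh] /pair_domainP[//|//|h' vh'].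
by apply/pair_domainP => //; exists (a *: h + h'); exact: pair_adjointD.
Qed.

Hypotheses (Alin : linear A) (Blin : linear B).

Lemma pair_relation_subspace : linear_subspace (pair_relation A B).
Proof.
split; first by exists 0; rewrite ?(linear_map0 Alin) ?(linear_map0 Blin).
by move=> a _ _ [u _ <-] [v _ <-]; exists (a *: u + v) => //; rewrite Alin Blin.
Qed.

Lemma closure_pair_adjoint h g k h' : closure (pair_relation A B) (h, g) ->
  pair_adjoint k h' -> inner g k = inner h h'.
Proof.
move=> /closure_pairP cl adj.
apply/eqP; rewrite -subr_eq0 -normr_le0; apply/ler_addgt0Pl => e e0; rewrite addr0.
have c0 : 0 < `|k| + `|h'| + 1 by rewrite ltr_wpDl ?addr_ge0.
have ec0 := divr_gt0 e0 c0.
have [_ [f _ <-] /= [/ltW hf /ltW gf]] := cl _ ec0.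
have -> : inner g k - inner h h' = inner (g - B f) k - inner (h - A f) h'.
  by rewrite !innerBl adj; ring.
apply: (le_trans (ler_normB _ _)).
have -> : e = e / (`|k| + `|h'| + 1) * (`|k| + `|h'| + 1) by rewrite divfK ?gt_eqF.
rewrite !mulrDr mulr1; apply: ler_wpDr; first exact: ltW.
by apply: lerD; apply: (le_trans (norm_inner _ _)); apply: ler_wpM2r.
Qed.

(** The closure of L(A,B) is its double adjoint.  If (h, g) annihilates all
    adjoint pairs, its residual modulo the closure gives an adjoint pair, which
    is then orthogonal to itself. *)
Lemma closure_pair_relation h g : closure (pair_relation A B) (h, g) <->
  forall k h', pair_adjoint k h' -> inner g k = inner h h'.
Proof.
split=> [cl k h'|biadj]; first exact: closure_pair_adjoint.
have [[h1 g1] cl orth] := closure_projection (h, g) pair_relation_subspace.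
have adj : pair_adjoint (g - g1) (- (h - h1)).
  move=> f; have /= := orth (A f, B f) (ex_intro2 _ _ f Logic.I erefl).
  move=> /eqP; rewrite addr_eq0 => /eqP eq1.
  by rewrite innerNr innerC [in RHS]innerC eq1 rmorphN opprK.
have := biadj _ _ adj; rewrite innerNr => eq0.
have eq1 := closure_pair_adjoint cl adj; rewrite innerNr in eq1.
have : inner (h - h1) (h - h1) + inner (g - g1) (g - g1) = 0.
  by rewrite [inner (h - _) _]innerBl [inner (g - _) _]innerBl eq0 eq1; ring.
move=> /eqP; rewrite paddr_eq0 ?inner_ge0// => /andP[/eqP/inner_eq0 + /eqP/inner_eq0].
by move=> /eqP; rewrite subr_eq0 => /eqP -> /eqP; rewrite subr_eq0 => /eqP ->.
Qed.

End PairAdjoint.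

(** * Resolvents of a positive relation *)

Section Resolvent.
Context {R : realType} {E H K : hilbertType R}.
Variables (A : E -> H) (B : E -> K).
Hypotheses (Alin : linear A) (Blin : linear B).
Local Notation L := (pair_relation A B).

(** The relation S = T T' for T the closure of L(A,B) and T' its adjoint.  It is
    neither everywhere defined nor single valued in general, so it is handled
    through its elements. *)
Definition closure_square x y := exists2 h, pair_adjoint A B x h & closure L (h, y).

Lemma closure_square_lin a x y x' y' : closure_square x y -> closure_square x' y' ->
  closure_square (a *: x + x') (a *: y + y').
Proof.
move=> [h xh hy] [h' xh' hy']; exists (a *: h + h'); first exact: pair_adjointD.
apply/(closure_pair_relation Alin Blin) => k l kl.
by rewrite !innerDl !innerZl (closure_pair_adjoint hy kl) (closure_pair_adjoint hy' kl).
Qed.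

Lemma closure_square_ge0 x y : closure_square x y -> 0 <= inner y x.
Proof. by move=> [h xh hy]; rewrite (closure_pair_adjoint hy xh) inner_ge0. Qed.

(** 1 + t S is injective because S is positive. *)
Lemma resolvent_inj (t : R[i]) x y x' y' : 0 <= t ->
  closure_square x y -> closure_square x' y' ->
  x + t *: y = x' + t *: y' -> x = x'.
Proof.
move=> t0 Sxy Sxy' eqk.
have := closure_square_ge0 (closure_square_lin (- 1) Sxy' Sxy).
rewrite !scaleN1r ![- _ + _]addrC => yx0.
have dE : x - x' = - (t *: (y - y')).
  have -> : x = x' + t *: y' - t *: y by rewrite -eqk addrK.
  by rewrite scalerBr opprB addrC -addrA addKr.
apply/eqP; rewrite -subr_eq0; apply/eqP/inner_eq0/le_anti.
by rewrite inner_ge0 andbT {1}dE innerNl innerZl oppr_le0 mulr_ge0.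
Qed.

(** 1 + t S is onto: project (0, k) on the closure of L(cA,B) with c = n + 1; the
    second component of the residual is the solution.  The scale enters through
    A, which turns S into S / c^2, whence the value t = c^-2. *)
Lemma resolvent_ex n k : exists x y, closure_square x y /\
  k = x + n.+1%:R^-2 *: y.
Proof.
pose c : R[i] := n.+1%:R.
have c0 : c != 0 by rewrite pnatr_eq0.
have cJ : c^* = c by rewrite conjC_nat.
have cVJ : (c^-1)^* = c^-1 by rewrite fmorphV; congr (_^-1); exact: cJ.
pose A' f := c *: A f.
have A'lin : linear A'.
  by move=> a u v; rewrite /A' Alin scalerDr !scalerA mulrC.
have [[h' g] cl orth] := closure_projection (0, k) (pair_relation_subspace A'lin Blin).
have adj : pair_adjoint A B (k - g) (c *: h').
  move=> f; have /= := orth (A' f, B f) (ex_intro2 _ _ f Logic.I erefl).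
  rewrite sub0r innerNl addrC => /eqP; rewrite subr_eq0 => /eqP eq1.
  by rewrite innerC eq1 -innerC innerZr innerZl cJ.
exists (k - g), (c ^+ 2 *: g); split; last first.
  by rewrite scalerA mulVf ?expf_neq0// scale1r subrK.
exists (c *: h') => //; apply/(closure_pair_relation Alin Blin) => k1 h1 adj1.
have adj1' : pair_adjoint A' B k1 (c^-1 *: h1).
  by move=> f; rewrite adj1 innerZr innerZl cVJ mulKf.
have eq1 := closure_pair_adjoint cl adj1'.
by rewrite !innerZl eq1 innerZr cVJ expr2 -mulrA mulVKf.
Qed.

(** With s <= t, the solutions x = (1 + tS)^-1 k and x' = (1 + sS)^-1 k are
    related by x' = x + (t - s) w, where w = S (1 + sS)^-1 x, and <w,x> >= 0 by
    positivity of S. *)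
Lemma resolvent_monotone n m x y x' y' : (n <= m)%N ->
  closure_square x y -> closure_square x' y' ->
  x + n.+1%:R^-2 *: y = x' + m.+1%:R^-2 *: y' -> inner x x <= inner x' x'.
Proof.
move=> nm Sxy Sxy' eqk.
set t := n.+1%:R^-2 in eqk; set s := m.+1%:R^-2 in eqk.
have s0 : 0 < s by rewrite invr_gt0 exprn_gt0 ?ltr0n.
have st : 0 <= t - s.
  by rewrite subr_ge0 lef_pV2 ?posrE ?exprn_gt0 ?ltr0n// ler_pXn2r ?nnegrE ?ler0n// ler_nat.
have [z [w [Szw xE]]] := resolvent_ex m x.
rewrite -/s in xE.
have sn0 : s != 0 by rewrite gt_eqF.
have xz : - 1 *: z + x = s *: w by rewrite xE scaleN1r addKr.
(* x' = (t/s) (x - z) + z, and this combination of x and z is in the domain of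
   the square, which is not clear for w alone. *)
have Sv := closure_square_lin (t / s) (closure_square_lin (- 1) Szw Sxy) Szw.
have x'E : x' = x + (t - s) *: w.
  rewrite xz scalerA divfK// in Sv.
  have -> : x + (t - s) *: w = t *: w + z.
    by rewrite xE -addrA -scalerDl addrCA subrr addr0 addrC.
  apply: (resolvent_inj (ltW s0) Sxy' Sv).
  rewrite -eqk scalerDr scalerA [s * _]mulrC divfK// scalerDr scaleN1r scalerN.
  by rewrite xE [t *: w + z]addrC -!addrA; congr (z + _); rewrite addNKr addrC.
rewrite x'E; apply: inner_le_add; rewrite innerZl mulr_ge0// xE innerDr innerZr.
rewrite addr_ge0 ?(closure_square_ge0 Szw)// mulr_ge0 ?inner_ge0//.
by rewrite conjC_ge0 ltW.
Qed.
End Resolvent.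

(** * Almost domination and closability *)

(** The values of a limit are only partially ordered in R[i], so comparisons
    pass to the limit through these approximate inequalities. *)
Lemma cvg_nonneg (R : realType) (a : nat -> R[i]) (l : R[i]) :
  (forall n, 0 <= a n) -> 0 <= l -> (a : nat -> R[i]^o) @ \oo --> (l : R[i]^o) ->
  forall d, 0 < d -> exists N, forall n, (N <= n)%N -> a n <= l + d /\ l <= a n + d.
Proof.
move=> a0 l0 /cvgrPdist_le al d /al[N _ NP]; exists N => n /NP /= lan.
rewrite -!lerBlDl; split; apply: (le_trans _ lan); first rewrite distrC.
  by rewrite real_ler_norm// realB ?ger0_real.
by rewrite real_ler_norm// realB ?ger0_real.
Qed.

Section Regularity.
Context {R : realType} {E H K : hilbertType R}.
Variables (A : E -> H) (B : E -> K).
Hypotheses (Alin : linear A) (Blin : linear B).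
Local Notation L := (pair_relation A B).

(** Density of D(A,B), as the triviality of its orthocomplement. *)
Definition adjoint_densely_defined :=
  forall u, (forall k h, pair_adjoint A B k h -> inner k u = 0) -> u = 0.

(** Write u = x + y with (x, y) in S, through an adjoint pair (x, h).  Then
    <x,u> = |x|^2 + |h|^2, so u orthogonal to D(A,B) gives x = 0
    and h = 0, and (0, u) is in the closure. *)
Lemma closure_operator_densely_defined :
  is_operator (closure L) -> adjoint_densely_defined.
Proof.
move=> op u uorth.
have [x [y [[h xh hy]]]] := resolvent_ex Alin Blin 0 u.
rewrite expr1n invr1 scale1r => uE.
have := uorth _ _ xh; rewrite uE innerDr innerC [inner x y]innerC -!innerC.
have -> : inner x y = inner h h by rewrite innerC (closure_pair_adjoint hy xh) -innerC.
move=> /eqP; rewrite paddr_eq0 ?inner_ge0// => /andP[/eqP/inner_eq0 x0 /eqP/inner_eq0 h0].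
rewrite x0 add0r; rewrite h0 in hy; apply: (op 0) => //.
by apply/(closure_pair_relation Alin Blin) => k h' _; rewrite !inner0l.
Qed.

Lemma densely_defined_closure_operator :
  adjoint_densely_defined -> is_operator (closure L).
Proof.
move=> dense h g g' hg hg'; apply/eqP; rewrite -subr_eq0; apply/eqP/dense.
move=> k h' adj; apply: inner_eq0C.
by rewrite innerBl (closure_pair_adjoint hg adj) (closure_pair_adjoint hg' adj) subrr.
Qed.

(** Let (0, g) be in the closure and Bf near g.  For Bf' near g with Af' small,
    |B_n f| is close to |B_n (f - f')| <= |Bf - Bf'|, a bound independent of n.
    Hence the supremum |Bf| is small, and so is g. *)
Lemma almost_dominated_closure_operator :
  almost_dominated A B -> is_operator (closure L).
Proof.
move=> [K_ [B_ [c [Bbd c0 AB]]]] h g g' hg hg'.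
have cl0 : closure L (0, g - g').
  apply/(closure_pair_relation Alin Blin) => k h' adj.
  rewrite innerBl (closure_pair_adjoint hg adj) (closure_pair_adjoint hg' adj).
  by rewrite subrr inner0l.
apply/eqP; rewrite -subr_eq0 -normr_le0; apply/ler_addgt0Pl => e e0; rewrite addr0.
have e30 : 0 < e / 2 by rewrite divr_gt0 ?ltr0n.
move: cl0 => /closure_pairP cl0.
have [_ [f _ <-] /= [_ /ltW gf]] := cl0 _ e30.
have near x := cvg_nonneg (fun n => normr_ge0 (B_ n x)) (normr_ge0 (B x)).
have B_le n x : `|B_ n x| <= `|B x|.
  have [_ mono cv] := AB x; apply/ler_addgt0Pr => d /(near x cv)[N NP].
  have incr m : `|B_ n x| <= `|B_ (n + m)%N x|.
    by elim: m => [|m IH]; rewrite ?addn0// addnS; exact: le_trans (mono _).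
  by apply: (le_trans (incr N)); have [] := NP _ (leq_addl n N).
have Bn n : `|B_ n f| <= e / 2.
  apply/ler_addgt0Pr => d d0.
  have c10 : 0 < c n + 1 by rewrite ltr_wpDl.
  have [_ [f' _ <-] /= [Af' /ltW gf']] := cl0 _ (divr_gt0 d0 c10).
  rewrite sub0r normrN in Af'.
  have [Blinn _] := Bbd n.
  have -> : B_ n f = B_ n (f - f') + B_ n f' by rewrite -(linear_mapD Blinn) subrK.
  have -> : e / 2 + d = (e / 2 + d / (c n + 1)) + c n * (d / (c n + 1)).
    by field; rewrite gt_eqF.
  apply: (le_trans (ler_normD _ _)); apply: lerD; last first.
    have [/(_ n) le1 _ _] := AB f'.
    by apply: (le_trans le1); apply: ler_wpM2l => //; exact: ltW.
  apply: (le_trans (B_le _ _)); rewrite (linear_mapB Blin).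
  have -> : B f - B f' = (g - g' - B f') - (g - g' - B f).
    by rewrite opprB [RHS]addrC addrA subrK.
  by apply: (le_trans (ler_normB _ _)); rewrite addrC; exact: lerD.
have Bf : `|B f| <= e / 2.
  have [_ _ cv] := AB f; apply/ler_addgt0Pr => d /(near f cv)[N NP].
  have [_ le1] := NP _ (leqnn N); apply: (le_trans le1).
  by rewrite lerD2r; exact: Bn.
have -> : g - g' = (g - g' - B f) + B f by rewrite subrK.
apply: (le_trans (ler_normD _ _)).
have -> : e = e / 2 + e / 2 by field.
exact: lerD.
Qed.

Lemma resolvent_function n : exists r : K -> K, forall k, exists y,
  closure_square A B (r k) y /\ k = r k + n.+1%:R^-2 *: y.
Proof. by have /choice[r rP] := resolvent_ex Alin Blin n; exists r. Qed.

Section ResolventFunction.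
Variables (n : nat) (r : K -> K).
Hypothesis rP : forall k, exists y,
  closure_square A B (r k) y /\ k = r k + n.+1%:R^-2 *: y.
Local Notation t := (n.+1%:R^-2 : R[i]).

Let t_gt0 : 0 < t. Proof. by rewrite invr_gt0 exprn_gt0 ?ltr0n. Qed.

Lemma resolvent_linear : linear r.
Proof.
move=> a u v.
have [y [S1 E1]] := rP (a *: u + v); have [y' [S2 E2]] := rP u; have [y'' [S3 E3]] := rP v.
apply: (resolvent_inj Alin Blin (ltW t_gt0) S1 (closure_square_lin Alin Blin a S2 S3)).
rewrite -E1 {1}E2 {1}E3 !scalerDr addrACA; congr (_ + (_ + _)).
by rewrite !scalerA mulrC.
Qed.

Lemma resolvent_contraction k : `|r k| <= `|k|.
Proof.
have [y [Sy kE]] := rP k; rewrite -[leRHS]mul1r; apply: sqr_norm_le => //.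
rewrite expr1n mul1r.
rewrite [in leRHS]kE; apply: inner_le_add.
by rewrite innerZl mulr_ge0 ?(closure_square_ge0 Sy)// ltW.
Qed.

(** If (x, h) is the adjoint pair through which x = r (Bf) is obtained and
    N = n + 1, then |x|^2 + |h|^2 / N^2 = <Af,h>, and the right side is at most
    N^2 |Af|^2 + |h|^2 / N^2. *)
Lemma resolvent_dominated f : `|r (B f)| <= n.+1%:R * `|A f|.
Proof.
have [y [[h xh hy] kE]] := rP (B f).
set x := r _ in xh kE *.
apply: sqr_norm_le; first exact: ler0n.
have eq1 : inner x x + t * inner h h = inner (A f) h.
  by rewrite -(xh f) [in RHS]kE innerDl innerZl (closure_pair_adjoint hy xh).
have x0 := inner_ge0 x; have h0 := inner_ge0 h.
have th0 : 0 <= t * inner h h by rewrite mulr_ge0// ltW.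
have := norm_inner (A f) h; rewrite -eq1 ger0_norm ?addr_ge0// -!sqr_norm_inner.
set N : R[i] := n.+1%:R.
have N0 : 0 < N by rewrite ltr0n.
set a := `|A f|; set b := `|h| => le1.
have a0 : 0 <= a := normr_ge0 _.
have b0 : 0 <= b := normr_ge0 _.
have sq : 0 <= (N * a - N^-1 * b) ^+ 2.
  rewrite -realEsqr; apply: realB; apply: ger0_real;
    apply: mulr_ge0 => //; last by rewrite invr_ge0 ltW.
have sqE : (N * a - N^-1 * b) ^+ 2 = N ^+ 2 * a ^+ 2 - 2 * (a * b) + N^-2 * b ^+ 2.
  by field; rewrite nat1r pnatr_eq0.
rewrite sqE in sq.
rewrite -subr_ge0 (_ : _ - _ = (N ^+ 2 * a ^+ 2 - 2 * (a * b) + N^-2 * b ^+ 2) +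
  (a * b - (`|x| ^+ 2 + N^-2 * b ^+ 2)) + a * b); last by ring.
by apply: addr_ge0; [apply: addr_ge0 => //; rewrite subr_ge0|apply: mulr_ge0].
Qed.

(** The squared norm of k - r k equals t (<l,h> - |l|^2), where (r k, l) is the
    adjoint pair of the resolvent, and this is at most t |h|^2. *)
Lemma resolvent_approximation k h : pair_adjoint A B k h ->
  `|k - r k| <= n.+1%:R^-1 * `|h|.
Proof.
move=> kh; have [y [[l xl ly] kE]] := rP k.
set x := r _ in xl kE *.
apply: sqr_norm_le; first by rewrite invr_ge0 ler0n.
have dE : k - x = t *: y by rewrite {1}kE addrC addKr.
have eq1 : inner (k - x) (k - x) = t * (inner l h - inner l l).
  rewrite {1}dE innerZl innerBr.
  by rewrite (closure_pair_adjoint ly kh) (closure_pair_adjoint ly xl).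
rewrite eq1 exprVn ler_pM2l//.
have lh0 : 0 <= inner l h - inner l l by rewrite -(pmulr_rge0 _ t_gt0) -eq1 inner_ge0.
have lh : 0 <= inner l h by rewrite -[inner l h](subrK (inner l l)) addr_ge0 ?inner_ge0.
have := norm_inner l h; rewrite ger0_norm// -!sqr_norm_inner => le1.
have sq : 0 <= (`|l| - `|h|) ^+ 2 by rewrite -realEsqr realB.
rewrite -subr_ge0 (_ : _ - _ = (`|l| - `|h|) ^+ 2 + (`|l| * `|h| - inner l h) +
  `|l| * `|h|); last by ring.
by apply: addr_ge0; [apply: addr_ge0 => //; rewrite subr_ge0|apply: mulr_ge0].
Qed.

End ResolventFunction.

(** The approximants (1 + S/n^2)^-1 B.  They converge at the vectors of the
    dense subspace D(A,B) with an explicit rate, and elsewhere because they are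
    contractions. *)
Lemma densely_defined_almost_dominated : bounded_operator B ->
  adjoint_densely_defined -> almost_dominated A B.
Proof.
move=> [_ [cB cBP]] dense.
have [r rP] := choice resolvent_function.
exists (fun=> K), (fun n f => r n (B f)), (fun n => n.+1%:R); split=> [n|n|f].
- split.
    by move=> a u v; rewrite Blin (resolvent_linear (rP n)).
  by exists cB => f; exact: (le_trans (resolvent_contraction (rP n) _)).
- exact: ler0n.
- split=> [n|n|].
  + exact: resolvent_dominated.
  + rewrite -[leRHS]mul1r; apply: sqr_norm_le => //; rewrite expr1n mul1r.
    have [y [S1 E1]] := rP n (B f); have [y' [S2 E2]] := rP n.+1 (B f).
    by apply: (resolvent_monotone Alin Blin (leqnSn n) S1 S2); rewrite -E1.
  + apply: (@cvg_norm _ K _ _ _ (fun n => r n (B f))).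
    apply/cvgrPdist_le => e e0.
    have e30 : 0 < e / 3 by rewrite divr_gt0 ?ltr0n.
    pose D : set K := [set k | exists h, pair_adjoint A B k h].
    have Dlin : linear_subspace D.
      split; first by exists 0; exact: pair_adjoint0.
      by move=> a u v [h uh] [h' vh]; exists (a *: h + h'); exact: pair_adjointD.
    have [q clq oq] := projection_closure (B f) Dlin.
    have qE : B f = q.
      apply/eqP; rewrite -subr_eq0; apply/eqP/dense => k h kh.
      by apply: oq; exists h.
    rewrite -qE in clq; move: clq => /closure_normP/(_ _ e30)[k [h kh] /ltW kf].
    have h10 : 0 < `|h| + 1 by rewrite ltr_wpDl.
    have [N NP] := small_invn (divr_gt0 e30 h10).
    exists N => // m /= Nm.
    have -> : B f - r m (B f) = (B f - k) + ((k - r m k) - r m (B f - k)).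
      rewrite (linear_mapB (resolvent_linear (rP m))) opprB !addrA.
      by rewrite subrK subrK.
    have -> : e = e / 3 + (e / 3 + e / 3) by field.
    apply: (le_trans (ler_normD _ _)); apply: lerD => //.
    apply: (le_trans (ler_normB _ _)); apply: lerD; last first.
      exact: (le_trans (resolvent_contraction (rP m) _)).
    apply: (le_trans (resolvent_approximation (rP m) kh)).
    have : m.+1%:R^-1 <= e / 3 / (`|h| + 1) := le_trans (invn_le Nm) (ltW NP).
    rewrite ler_pdivlMr//; apply: le_trans.
    by apply: ler_wpM2l; rewrite ?invr_ge0 ?ler0n// lerDl.
Qed.

End Regularity.

(** * Singularity *)

Section Domination.
Context {R : realType} {E H K : hilbertType R}.
Variables (A : E -> H) (B : E -> K).

Lemma dominated_of_bound (c : R[i]) : (forall f, `|B f| <= c * `|A f|) -> dominated A B.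
Proof.
move=> BA; exists (`|c| + 1); first by rewrite ltr_wpDl.
move=> f; apply: (le_trans (BA f)).
apply: (@le_trans _ _ (`|c| * `|A f|)); first by apply: le_norm_mul => //; exact: le_trans (BA f).
by apply: ler_wpM2r => //; rewrite lerDl.
Qed.

End Domination.

Section Singularity.
Context {R : realType} {E H K : hilbertType R}.
Variables (A : E -> H) (B : E -> K).

Definition adjoint_vanishes := forall k h, pair_adjoint A B k h -> forall f, inner (B f) k = 0.

(** Test singularity on the rank one operator x |-> <Bx,k> f = <Ax,h> f. *)
Lemma singular_wrt_adjoint_vanishes : bounded_operator A -> linear B ->
  singular_wrt A B -> adjoint_vanishes.
Proof.
move=> [Alin [c Ac]] Blin sing k h adj f.
pose D x := inner (B x) k *: f.
have DA x : `|D x| <= `|h| * `|f| * `|A x|.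
  rewrite normrZ [leRHS]mulrAC adj ler_wpM2r// mulrC; exact: norm_inner.
have DB x : `|D x| <= `|k| * `|f| * `|B x|.
  rewrite normrZ [leRHS]mulrAC ler_wpM2r// mulrC; exact: norm_inner.
have Dbd : bounded_operator D.
  split; first by move=> a u v; rewrite /D Blin innerDl innerZl scalerDl scalerA.
  exists (`|h| * `|f| * c) => x; apply: (le_trans (DA x)).
  by rewrite -[leRHS]mulrA; apply: ler_wpM2l; [exact: mulr_ge0|exact: Ac].
have D0 := sing _ Dbd (dominated_of_bound DA) (dominated_of_bound DB).
have /eqP := congr1 (@^~ f) D0; rewrite /D /cst /= scaler_eq0 => /orP[/eqP//|/eqP ->].
by rewrite (linear_map0 Blin) inner0l.
Qed.

(** If D is dominated by A and by B, then f |-> <Df,g> factors through both,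
    so that it comes from an adjoint pair. *)
Lemma adjoint_vanishes_singular_wrt : linear A -> linear B ->
  adjoint_vanishes -> singular_wrt A B.
Proof.
move=> Alin Blin van D [Dlin _] [c c0 DA] [d d0 DB].
apply/funext => f; apply: inner_eq0; rewrite /cst.
pose phi x := inner (D x) (D f).
have philin a u v : phi (a *: u + v) = a * phi u + phi v.
  by rewrite /phi Dlin innerDl innerZl.
have factor (Y : hilbertType R) (T : E -> Y) (b : R[i]) : linear T ->
    (forall x, `|D x| <= b * `|T x|) -> exists y, forall x, phi x = inner (T x) y.
  move=> Tlin DT; apply: (functional_factor (c := b * `|D f|) Tlin philin) => x.
  by apply: (le_trans (norm_inner _ _)); rewrite mulrAC ler_wpM2r.
have [h hP] := factor _ _ _ Alin DA; have [k kP] := factor _ _ _ Blin DB.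
rewrite -/(phi f) kP; apply: (van k h) => x.
by rewrite -hP -kP.
Qed.

Lemma rel_singular_adjoint_vanishes : linear A -> linear B ->
  rel_singular (pair_relation A B) -> adjoint_vanishes.
Proof.
move=> Alin Blin [M [N [[M0 _] _ _ _ clE]]] k h adj f.
have : closure (pair_relation A B) (A f, B f) by apply: subset_closure; exists f.
rewrite clE => -[_ /= Nf].
have : closure (pair_relation A B) (0, B f) by rewrite clE; split.
by move=> /closure_pair_adjoint/(_ adj) ->; rewrite inner0l.
Qed.

(** The adjoint relation is then the product of the orthocomplements of ran B and
    ran A, so the double adjoint is a product too. *)
Lemma adjoint_vanishes_rel_singular : linear A -> linear B ->
  adjoint_vanishes -> rel_singular (pair_relation A B).
Proof.
move=> Alin Blin van.
exists (orthocompl (orthocompl (range A))), (orthocompl (orthocompl (range B))).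
split; [exact: orthocompl_subspace|exact: orthocompl_closed|exact: orthocompl_subspace|
  exact: orthocompl_closed|].
rewrite eqEsubset; split=> [[h g] cl|[h g] [/= oh og]].
  split=> /= [l ol|k ok]; apply: inner_eq0C.
    have adj : pair_adjoint A B 0 l by move=> f; rewrite inner0r ol//; exists f.
    by rewrite -(closure_pair_adjoint cl adj) inner0r.
  have adj : pair_adjoint A B k 0 by move=> f; rewrite inner0r ok//; exists f.
  by rewrite (closure_pair_adjoint cl adj) inner0r.
apply/(closure_pair_relation Alin Blin) => k l adj.
have B0 := van _ _ adj.
rewrite (inner_eq0C (og k _)) ?(inner_eq0C (oh l _))//.
  by move=> _ [f _ <-]; rewrite -adj B0.
by move=> _ [f _ <-]; rewrite B0.
Qed.

End Singularity.

(** * Uniform boundedness *)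

Section UniformBoundedness.
Context {R : realType}.

(** One of the points x + u and x - u, with u the multiple of g of norm r, will
    do, since their inner products with g differ by 2 r |g|. *)
Lemma gliding_step (X : hilbertType R) (g x : X) (r : R[i]) : 0 <= r ->
  exists y, `|y - x| <= r /\ r * `|g| <= `|inner y g|.
Proof.
move=> r0; have [->|g0] := eqVneq g 0.
  by exists x; rewrite subrr !normr0 mulr0 inner0r normr0.
have ng0 : `|g| != 0 by rewrite normr_eq0.
pose u := (r / `|g|) *: g.
have nu : `|u| = r by rewrite normrZ normrM normfV normr_id ger0_norm// divfK.
have ug : inner u g = r * `|g|.
  by rewrite innerZl -sqr_norm_inner expr2 mulrA divfK.
have [le|] := boolP (r * `|g| <= `|inner (x + u) g|).
  by exists (x + u); rewrite addrC addKr nu.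
rewrite -real_ltNge ?realM ?ger0_real// => lt1.
exists (x - u); rewrite addrC addKr normrN nu; split => //.
have [//|] := boolP (r * `|g| <= `|inner (x - u) g|).
rewrite -real_ltNge ?realM ?ger0_real// => lt2.
have := ltrD lt1 lt2; rewrite -ug => lt.
have : `|inner (x + u) g - inner (x - u) g| < inner u g + inner u g.
  by apply: le_lt_trans (ler_normB _ _) lt.
have -> : inner (x + u) g - inner (x - u) g = inner u g + inner u g.
  by rewrite innerDl innerBl; ring.
by rewrite ger0_norm ?ltxx// ug addr_ge0 ?mulr_ge0.
Qed.

(** The uniform boundedness principle for functionals <.,g>, by a gliding hump:
    if G contains vectors g_n with |g_n| >= 2 (n+1) 3^n, the steps of length 3^-n
    given by [gliding_step] converge to a point x whose inner products with g_n
    are unbounded, because the steps after the n-th one undo at most half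
    of the gain at g_n. *)
Theorem weakly_bounded_bounded (X : hilbertType R) (G : set X) :
  (forall x, exists M : R[i], forall g, G g -> `|inner x g| <= M) ->
  exists M : R[i], forall g, G g -> `|g| <= M.
Proof.
move=> wb; apply: contrapT => unb.
have large n : exists g, G g /\ 2 * n.+1%:R * 3 ^+ n <= `|g| :> R[i].
  apply: contrapT => small; apply: unb; exists (2 * n.+1%:R * 3 ^+ n) => g Gg.
  apply/ltW; rewrite real_ltNge ?normr_real//; last first.
    by rewrite -natrX -!natrM realn.
  by apply/negP => le; apply: small; exists g.
have [g gP] := choice large.
pose q n : R[i] := 3 ^- n.
have q0 n : 0 < q n by rewrite invr_gt0 exprn_gt0 ?ltr0n.
have qS n : q n = 3 * q n.+1.
  by rewrite /q exprS invfM mulrA mulfV ?mul1r ?pnatr_eq0.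
have step (p : nat * X) : exists y, `|y - p.2| <= q p.1 /\ q p.1 * `|g p.1| <= `|inner y (g p.1)|.
  exact/gliding_step/ltW.
have [F FP] := choice step.
(* u n.+1 is the point whose inner product with g n is large. *)
pose fix u n := if n is m.+1 then F (m, u m) else 0.
have uS n : `|u n.+1 - u n| <= q n by have [] := FP (n, u n).
have ug n : q n * `|g n| <= `|inner (u n.+1) (g n)| by have [] := FP (n, u n).
have ucau m n : `|u m - u (m + n)%N| <= (q m - q (m + n)%N) * 3 / 2.
  elim: n => [|n IH]; first by rewrite addn0 !subrr normr0 !mul0r.
  rewrite addnS; have -> : u m - u (m + n).+1 =
      (u m - u (m + n)%N) - (u (m + n).+1 - u (m + n)%N).
    by rewrite opprB addrA subrK.
  apply: (le_trans (ler_normB _ _)).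
  have -> : (q m - q (m + n).+1) * 3 / 2 = (q m - q (m + n)%N) * 3 / 2 + q (m + n)%N.
    by rewrite (qS (m + n)%N); field.
  exact: lerD.
have udist m n : (m <= n)%N -> `|u m - u n| <= 3 / 2 * q m.
  move=> /subnKC <-; apply: (le_trans (ucau _ _)).
  rewrite -mulrA mulrC ler_wpM2l ?divr_ge0 ?ler0n// gerBl; exact: ltW.
have qle n : q n <= n.+1%:R^-1.
  rewrite lef_pV2 ?posrE ?exprn_gt0 ?ltr0n// -natrX ler_nat; exact: ltn_expl.
have c0 : 0 < (3 / 2) ^+ 2 :> R[i] by rewrite exprn_gt0 ?divr_gt0 ?ltr0n.
have [|x xP] := cauchy_seq_limit (u := u) c0.
  move=> m n mn.
  have : `|u m - u n| ^+ 2 <= (3 / 2 * q m) ^+ 2.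
    have nn : 0 <= 3 / 2 * q m by rewrite mulr_ge0 ?divr_ge0 ?ler0n// ltW.
    by rewrite ler_pXn2r ?nnegrE//; exact: udist.
  move=> /le_trans; apply; rewrite exprMn ler_pM2l// expr2 -[leRHS]mulr1.
  apply: ler_pM => //; first [exact: ltW|idtac]; apply: (le_trans (qle m)).
  by rewrite invf_le1 ?ltr0n// ler1n.
have xu n : `|x - u n| <= 3 / 2 * q n.
  apply/ler_addgt0Pr => e /xP[N NP].
  have -> : x - u n = (x - u (maxn n N)) - (u n - u (maxn n N)).
    by rewrite opprB addrA subrK.
  apply: (le_trans (ler_normB _ _)); rewrite addrC; apply: lerD.
    by apply: udist; rewrite leq_maxl.
  by apply/ltW/NP; rewrite leq_maxr.
have big n : n.+1%:R <= `|inner x (g n)|.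
  have qg : 2 * n.+1%:R <= q n * `|g n|.
    have [_ le1] := gP n; by rewrite [leRHS]mulrC /q ler_pdivlMr ?exprn_gt0 ?ltr0n.
  have half : `|inner (u n.+1) (g n)| <= `|inner x (g n)| + 2^-1 * (q n * `|g n|).
    have -> : inner (u n.+1) (g n) = inner x (g n) - inner (x - u n.+1) (g n).
      by rewrite innerBl; ring.
    apply: (le_trans (ler_normB _ _)); rewrite lerD2l.
    apply: (le_trans (norm_inner _ _)); rewrite mulrA ler_wpM2r//.
    by apply: (le_trans (xu _)); rewrite (qS n) mulrA [2^-1 * 3]mulrC.
  have := le_trans (ug n) half; rewrite -lerBlDr.
  have -> : q n * `|g n| - 2^-1 * (q n * `|g n|) = 2^-1 * (q n * `|g n|) by field.
  by apply: le_trans; rewrite mulrC ler_pdivlMr ?ltr0n// mulrC.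
have [M MP] := wb x.
have M0 : 0 <= M by apply: le_trans (MP _ (gP 0%N).1).
have M10 : 0 < M + 1 by rewrite ltr_wpDl.
have [n nM] : exists n, n.+1%:R^-1 < (M + 1)^-1 :> R[i] by apply: small_invn; rewrite invr_gt0.
have := le_trans (big n) (MP _ (gP n).1).
move: nM; rewrite ltf_pV2 ?posrE ?ltr0n// => lt1 le2.
by have := lt_le_trans lt1 le2; rewrite gtrDl ltr10.
Qed.

(** Uniform boundedness of the set of all Cf with |Af| <= 1.  Normalizing f
    by |Af| + e / (M + 1) instead of |Af| covers the case Af = 0. *)
Lemma weakly_dominated_dominated (E H K : hilbertType R) (A : E -> H) (C : E -> K) :
  linear A -> linear C ->
  (forall x, exists M : R[i], forall f, `|inner x (C f)| <= M * `|A f|) ->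
  dominated A C.
Proof.
move=> Alin Clin wd.
pose G : set K := [set C f | f in [set f | `|A f| <= 1]].
have [|M MP] := @weakly_bounded_bounded K G.
  move=> x; have [M MP] := wd x; exists `|M| => _ [f /= f1 <-].
  apply: (le_trans (MP f)).
  apply: (@le_trans _ _ (`|M| * `|A f|)).
    by apply: le_norm_mul => //; exact: le_trans (MP f).
  by rewrite ler_piMr.
apply: (dominated_of_bound (c := M)) => f.
have M0 : 0 <= M.
  apply: le_trans (MP 0 _); first by [].
  by exists 0; rewrite /= ?(linear_map0 Alin) ?(linear_map0 Clin)// normr0.
apply/ler_addgt0Pr => e e0.
have M10 : 0 < M + 1 by rewrite ltr_wpDl.
pose d := `|A f| + e / (M + 1).
have d0 : 0 < d by rewrite ltr_wpDl// divr_gt0.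
have : `|C (d^-1 *: f)| <= M.
  apply: MP; exists (d^-1 *: f) => //=.
  rewrite (linear_mapZ Alin) normrZ normfV (gtr0_norm d0) mulrC ler_pdivrMr// mul1r.
  by rewrite lerDl divr_ge0 ?ltW.
rewrite (linear_mapZ Clin) normrZ normfV (gtr0_norm d0) mulrC ler_pdivrMr//.
move=> /le_trans; apply; rewrite mulrDr lerD2l mulrCA ler_piMr ?(ltW e0)//.
by rewrite ler_pdivrMr// mul1r lerDl.
Qed.

End UniformBoundedness.

(** * Lebesgue type decompositions of operators *)

Section LebesgueDecomposition.
Context {R : realType} {E H K : hilbertType R}.
Variables (A : E -> H) (B : E -> K).
Hypotheses (Abd : bounded_operator A) (Bbd : bounded_operator B).
Local Notation D := (pair_domain A B).

Let Alin : linear A. Proof. by case: Abd. Qed.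
Let Blin : linear B. Proof. by case: Bbd. Qed.
Let Dlin : linear_subspace D. Proof. exact: pair_domain_subspace. Qed.

Lemma almost_dominatedP (C : E -> K) : bounded_operator C ->
  almost_dominated A C <-> adjoint_densely_defined A C.
Proof.
move=> Cbd; have [Clin _] := Cbd; split.
  by move=> /(almost_dominated_closure_operator Alin Clin);
    exact: closure_operator_densely_defined.
exact: densely_defined_almost_dominated.
Qed.

Lemma sing_part_in f : orthocompl D (sing_part A B f).
Proof. by have [] := orthoproj_orthocompl (B f) Dlin. Qed.

Lemma reg_part_in f : orthocompl (orthocompl D) (reg_part A B f).
Proof. by have [] := orthoproj_orthocompl (B f) Dlin. Qed.

Lemma reg_sing_part f : B f = reg_part A B f + sing_part A B f.
Proof. by rewrite /reg_part subrK. Qed.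

Lemma reg_sing_partE f b s : B f = b + s -> orthocompl (orthocompl D) b ->
  orthocompl D s -> reg_part A B f = b /\ sing_part A B f = s.
Proof.
move=> BE bD sD.
have sE : sing_part A B f = s.
  by apply: (orthoproj_eq (orthocompl_subspace D) sD); rewrite BE addrK.
by rewrite /reg_part -/(sing_part A B f) sE BE addrK.
Qed.

Lemma reg_sing_part_linear : linear (reg_part A B) /\ linear (sing_part A B).
Proof.
have lin a u v : reg_part A B (a *: u + v) = a *: reg_part A B u + reg_part A B v /\
    sing_part A B (a *: u + v) = a *: sing_part A B u + sing_part A B v.
  apply: reg_sing_partE.
  - by rewrite Blin [B u]reg_sing_part [B v]reg_sing_part scalerDr addrACA.
  - by apply: (orthocompl_subspace (orthocompl D)).2; exact: reg_part_in.
  - by apply: (orthocompl_subspace D).2; exact: sing_part_in.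
by split=> a u v; have [] := lin a u v.
Qed.

Lemma bounded_summands (C S : E -> K) : linear C -> linear S ->
  (forall f, B f = C f + S f) -> (forall f, inner (C f) (S f) = 0) ->
  bounded_operator C /\ bounded_operator S.
Proof.
move=> Clin Slin BE orth; have [_ [c Bc]] := Bbd.
by split; split=> //; exists c => f; apply: le_trans (Bc f); rewrite BE;
  have [] := orthogonal_summands_le (orth f).
Qed.

Lemma inner_reg_sing f g : inner (reg_part A B f) (sing_part A B g) = 0.
Proof. by apply: inner_eq0C; apply: (reg_part_in f); exact: sing_part_in. Qed.

Lemma reg_sing_part_bounded :
  bounded_operator (reg_part A B) /\ bounded_operator (sing_part A B).
Proof.
have [lr ls] := reg_sing_part_linear; apply: bounded_summands => // f.
  exact: reg_sing_part.
exact: inner_reg_sing.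
Qed.

Lemma inner_reg_part f k : orthocompl (orthocompl D) k ->
  inner (reg_part A B f) k = inner (B f) k.
Proof.
move=> kD; rewrite [in RHS]reg_sing_part innerDl (kD (sing_part A B f)) ?addr0//.
exact: sing_part_in.
Qed.

Lemma inner_sing_part f k : orthocompl D k ->
  inner (sing_part A B f) k = inner (B f) k.
Proof.
move=> kD; rewrite [in RHS]reg_sing_part innerDl [inner (reg_part _ _ _) k]inner_eq0C ?add0r//.
exact: (reg_part_in f).
Qed.

(** D(A,B_reg) contains D(A,B), where B_reg and B have the same adjoint, and the
    orthocomplement of D(A,B), where the adjoint of B_reg vanishes. *)
Lemma reg_part_densely_defined : adjoint_densely_defined A (reg_part A B).
Proof.
move=> u uorth.
have uD : orthocompl D u.
  move=> k Dk; have /(pair_domainP _ Abd Bbd)[h adj] := Dk; apply: (uorth k h) => f.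
  by rewrite inner_reg_part ?adj//; exact: orthocompl_double.
apply: inner_eq0; apply: (uorth u 0) => f.
by rewrite inner0r; apply/inner_eq0C; exact: (reg_part_in f).
Qed.

(** If k is in D(A,B_sing), its component in the orthocomplement of D(A,B) lies
    in D(A,B) too, hence is 0. *)
Lemma sing_part_adjoint_vanishes : adjoint_vanishes A (sing_part A B).
Proof.
move=> k h adj f.
have [s sD ks] := orthocompl_decomposition k Dlin.
have kE g : inner (sing_part A B g) k = inner (sing_part A B g) s.
  rewrite -[in LHS](subrK s k) innerDr ks ?add0r//; exact: sing_part_in.
have Ds : D s.
  by apply/(pair_domainP _ Abd Bbd); exists h => g; rewrite -inner_sing_part// -kE adj.
by rewrite kE (orthocompl_self Ds sD) inner0r.
Qed.

Lemma lebesgue_typeP (B1 B2 : E -> K) : lebesgue_type A B B1 B2 <->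
  [/\ bounded_operator B1 /\ bounded_operator B2, B = B1 \+ B2,
      orthogonal_sets (range B1) (range B2),
      adjoint_densely_defined A B1 & adjoint_vanishes A B2].
Proof.
split=> -[[bd1 bd2] BE orth P1 P2]; split=> //.
- exact/almost_dominatedP.
- by apply: singular_wrt_adjoint_vanishes => //; case: bd2.
- exact/almost_dominatedP.
- by apply: adjoint_vanishes_singular_wrt => //; case: bd2.
Qed.

Theorem lebesgue_decomposition : lebesgue_type A B (reg_part A B) (sing_part A B).
Proof.
apply/lebesgue_typeP; split.
- exact: reg_sing_part_bounded.
- by apply/funext => f; exact: reg_sing_part.
- by move=> _ _ [f _ <-] [g _ <-]; exact: inner_reg_sing.
- exact: reg_part_densely_defined.
- exact: sing_part_adjoint_vanishes.
Qed.

(** With q the rank one operator sending f to the component of Bf along x, the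
    operators B_reg - q and B_sing + q form another decomposition.  The singular
    part stays singular because the span of x and the orthocomplement of D meets
    D only in 0; the regular part stays regular because D meets the
    orthocomplement of x in a subspace dense in what remains; and q is nonzero as
    (x, 0) is not an adjoint pair. *)
Theorem ando_decomposition x : orthocompl (orthocompl D) x -> ~ D x ->
  exists B1 B2, lebesgue_type A B B1 B2 /\ B1 <> reg_part A B.
Proof.
move=> xDD nDx.
have x0 : inner x x != 0.
  by apply/eqP => /inner_eq0 xE; apply: nDx; rewrite xE; exact: Dlin.1.
pose q f := (inner (B f) x / inner x x) *: x.
have qlin : linear q.
  move=> a u v; rewrite /q Blin innerDl innerZl mulrDl scalerDl.
  by rewrite scalerA mulrA.
pose B1 f := reg_part A B f - q f.
pose B2 f := sing_part A B f + q f.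
have [rlin slin] := reg_sing_part_linear.
have B1x f : inner (B1 f) x = 0.
  by rewrite innerBl inner_reg_part// innerZl divfK// subrr.
have B1in f : orthocompl (orthocompl D) (B1 f).
  apply: (subspaceB (orthocompl_subspace _)); first exact: reg_part_in.
  exact: (subspaceZ (orthocompl_subspace _)).
have orth f g : inner (B1 f) (B2 g) = 0.
  rewrite innerDr innerZr B1x mulr0 addr0; apply: inner_eq0C; apply: (B1in f).
  exact: sing_part_in.
have BE f : B f = B1 f + B2 f.
  by rewrite /B1 /B2 addrACA addNr addr0 -reg_sing_part.
have B1lin : linear B1.
  by move=> a u v; rewrite /B1 rlin qlin opprD addrACA -scalerBr.
have B2lin : linear B2.
  by move=> a u v; rewrite /B2 slin qlin scalerDr addrACA.
exists B1, B2; split; last first.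
  move=> B1E; apply: nDx; apply/(pair_domainP _ Abd Bbd); exists 0 => f.
  have /eqP := congr1 (@^~ f) B1E; rewrite /B1 -subr_eq0 addrAC subrr add0r oppr_eq0.
  move=> /eqP qf; rewrite inner0r -[LHS](divfK x0) -innerZl.
  by rewrite [_ *: x]qf inner0l.
apply/lebesgue_typeP; split.
- exact: bounded_summands.
- exact/funext.
- by move=> _ _ [f _ <-] [g _ <-]; exact: orth.
- move=> u uorth.
  have adjB1 k h : pair_adjoint A B k h -> inner k x = 0 -> pair_adjoint A B1 k h.
    move=> kh kx f; rewrite innerBl innerZl (inner_eq0C kx) mulr0 subr0.
    rewrite inner_reg_part ?kh//; apply: orthocompl_double.
    by apply/(pair_domainP _ Abd Bbd); exists h.
  have xu : inner x u = 0 by apply: (uorth x 0) => f; rewrite B1x inner0r.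
  have uDD : orthocompl (orthocompl D) u.
    move=> s sD; apply: (uorth s 0) => f; rewrite inner0r; apply: inner_eq0C.
    exact: (B1in f).
  have [d0 [Dd0 d0x]] : exists d0, D d0 /\ inner d0 x != 0.
    apply: contrapT => none; move/negP: x0; apply; apply/eqP; apply: (xDD x).
    move=> d Dd; apply/eqP; apply: contrapT => /negP dx; apply: none.
    by exists d.
  have /(pair_domainP _ Abd Bbd)[h0 adj0] := Dd0.
  pose mu := inner d0 u / inner d0 x.
  (* u and a multiple of x have the same inner products with all of D: subtract a
     multiple of d0 from d to land in the orthocomplement of x. *)
  have dmu d : D d -> inner d u = inner d x * mu.
    move=> /(pair_domainP _ Abd Bbd)[h adj].
    pose a := inner d x / inner d0 x.
    have : inner (- a *: d0 + d) u = 0.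
      apply: (uorth _ _ (adjB1 _ _ (pair_adjointD (- a) adj0 adj) _)).
      by rewrite innerDl innerZl mulNr divfK// addNr.
    rewrite innerDl innerZl mulNr addrC => /eqP; rewrite subr_eq0 => /eqP ->.
    by rewrite /a /mu; ring.
  have ux : u - mu^* *: x = 0.
    apply: (@orthocompl_self _ _ (orthocompl D)); last first.
      apply: (subspaceB (orthocompl_subspace _)) => //.
      exact: (subspaceZ (orthocompl_subspace _)).
    by move=> d Dd; rewrite innerBr innerZr conjCK dmu// mulrC subrr.
  apply: inner_eq0; move/eqP: ux; rewrite subr_eq0 => /eqP uE.
  by rewrite {1}uE innerZl xu mulr0.
- move=> k h adj f.
  have [s sD ks] := orthocompl_decomposition k Dlin.
  pose lam := inner k x / inner x x.
  (* s + lam x is the projection of k on the span of x and the orthocomplement of D. *)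
  have B2k g : inner (B2 g) k = inner (B g) (s + lam *: x).
    have sk : inner (sing_part A B g) (k - s) = 0 by apply: ks; exact: sing_part_in.
    move/eqP: sk; rewrite innerBr subr_eq0 => /eqP sk.
    rewrite /B2 innerDl sk inner_sing_part// innerDr; congr (_ + _).
    rewrite innerZl innerZr /lam rmorphM/= fmorphV/=.
    have -> : (inner k x)^* = inner x k by rewrite -innerC.
    have -> : (inner x x)^* = inner x x by rewrite -innerC.
    by ring.
  have Dm : D (s + lam *: x).
    by apply/(pair_domainP _ Abd Bbd); exists h => g; rewrite -B2k adj.
  have s0 : s = 0.
    apply: (@orthocompl_self _ _ (orthocompl D)) => //.
    rewrite -[s](addrK (lam *: x)).
    apply: (subspaceB (orthocompl_subspace _)); first exact: orthocompl_double.
    exact: (subspaceZ (orthocompl_subspace _)).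
  rewrite B2k s0 add0r; rewrite s0 add0r in Dm.
  have [->|lam0] := eqVneq lam 0; first by rewrite scale0r inner0r.
  exfalso; apply: nDx; rewrite -[x]scale1r -(mulVf lam0) -scalerA.
  exact: (subspaceZ Dlin).
Qed.

(** With N = ran B2, the adjoints of B and B1 agree on the orthocomplement of N,
    so density of D(A,B1) puts that orthocomplement into the closure of D.  As D
    is closed, it contains ran B1; and each x in D has its N-component in D,
    which singularity of B2 makes orthogonal to ran B2. *)
Theorem closed_lebesgue_unique B1 B2 : closed D -> lebesgue_type A B B1 B2 ->
  B1 = reg_part A B /\ B2 = sing_part A B.
Proof.
move=> /(orthocompl_double_closed Dlin) Dcl.
move=> /lebesgue_typeP[[[B1lin _] [B2lin _]] BE orth dense van].
pose N : set K := range B2.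
have Nlin : linear_subspace N.
  split; first by exists 0 => //; exact: linear_map0.
  by move=> a _ _ [u _ <-] [v _ <-]; exists (a *: u + v) => //; rewrite B2lin.
have BfE f : B f = B1 f + B2 f by rewrite BE.
have B1N f : orthocompl N (B1 f).
  by move=> _ [g _ <-]; apply: inner_eq0C; apply: orth; [exists f|exists g].
have ND : orthocompl N `<=` D.
  move=> k kN; apply: Dcl => u uD.
  have [a aN ua] := orthocompl_decomposition u Nlin.
  have a0 : a = 0.
    apply: dense => x h adj.
    have [b bN xb] := orthocompl_decomposition x Nlin.
    have Db : D b.
      apply/(pair_domainP _ Abd Bbd); exists h => f.
      rewrite -adj BfE innerDl (bN (B2 f)) ?addr0; last by exists f.
      by rewrite -[x in RHS](subrK b) innerDr xb ?add0r//; exact: B1N.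
    have ba : inner b a = 0.
      have := ua _ bN; rewrite innerBr [inner b u]uD// sub0r => /eqP.
      by rewrite oppr_eq0 => /eqP.
    by rewrite -[x](subrK b) innerDl ba addr0; exact/inner_eq0C/xb.
  by rewrite a0 subr0 in ua; exact/inner_eq0C/ua.
have key f : reg_part A B f = B1 f /\ sing_part A B f = B2 f.
  apply: reg_sing_partE => //.
    by apply: orthocompl_double; apply: ND.
  move=> x Dx; apply: inner_eq0C.
  have [a aN xa] := orthocompl_decomposition x Nlin.
  have Dxa : D (x - a) by apply: (subspaceB Dlin) => //; exact: ND.
  have B2x : inner (B2 f) x = inner (B2 f) (x - a).
    by rewrite innerBr (aN (B2 f)) ?subr0//; exists f.
  rewrite B2x; have /(pair_domainP _ Abd Bbd)[h adj] := Dxa.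
  apply: (van _ h) => g; rewrite -adj BfE innerDl [inner (B1 g) _]xa ?add0r//.
by split; apply/funext => f; have [] := key f.
Qed.

End LebesgueDecomposition.

(** * Lebesgue type decompositions of relations *)

Section RelationDecompositions.
Context {R : realType} {E H K : hilbertType R}.
Variables (A : E -> H) (B : E -> K).
Hypotheses (Abd : bounded_operator A) (Bbd : bounded_operator B).
Local Notation L C := (pair_relation A C).

Let Alin : linear A. Proof. by case: Abd. Qed.
Let Blin : linear B. Proof. by case: Bbd. Qed.

(** If L(A,C) is an operator, then Cf is its value at Af. *)
Lemma pair_relation_inj (C C' : E -> K) :
  is_operator (closure (L C)) -> L C = L C' -> C = C'.
Proof.
move=> op LE; apply/funext => f; apply: (op (A f)); apply: subset_closure.
  by exists f.
by rewrite LE; exists f.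
Qed.

Lemma lebesgue_type_operator B1 B2 : lebesgue_type A B B1 B2 -> is_operator (closure (L B1)).
Proof.
move=> /(lebesgue_typeP B Abd)[[[B1lin _] _] _ _ dense _].
exact: densely_defined_closure_operator.
Qed.

(** The sum of L(A,B1) and L(A,B2) only matches first components Af = Af', and
    L(A,B) is recovered from it because Af = Af' forces B1 f = B1 f'. *)
Lemma lebesgue_type_rel B1 B2 : lebesgue_type A B B1 B2 ->
  rel_lebesgue_type (L B) (L B1) (L B2).
Proof.
move=> leb; have op := lebesgue_type_operator leb.
have /(lebesgue_typeP B Abd)[[[B1lin _] [B2lin _]] BE orth dense van] := leb.
have domL C : (L C).`1 = range A.
  by rewrite eqEsubset; split=> [_ [y [f _ [<- _]]]|_ [f _ <-]]; [exists f|exists (C f), f].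
have ranL C y : (L C).`2 y -> range C y by move=> [x [f _ [_ <-]]]; exists f.
split.
- by split; exact: pair_relation_subspace.
- rewrite eqEsubset; split=> [_ [f _ <-]|[x y] [g1 [g2 [[f _ [fx fg]] [f' _ [fx' fg']] yE]]]].
    by exists (B1 f), (B2 f); split; [exists f|exists f|rewrite BE].
  rewrite /= in yE fx fx'; exists f' => //; rewrite yE fx' BE /= fg'; congr (_, _ + _).
  by apply: (op x); apply: subset_closure;
    [exists f' => //; rewrite fx'|exists f => //; rewrite fx fg].
- by rewrite !domL.
- by move=> x y /ranL rx /ranL ry; exact: orth.
- by split=> //; exact: adjoint_vanishes_rel_singular.
Qed.

(** Orthogonality of the ranges makes the splitting of Bf along T1 and T2
    unique, so B1 f and B2 f are well defined, linear and bounded by |Bf|. *)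
Lemma rel_lebesgue_type_operators (T1 T2 : set (H * K)) :
  rel_lebesgue_type (L B) T1 T2 ->
  exists B1 B2, [/\ lebesgue_type A B B1 B2, T1 = L B1 & T2 = L B2].
Proof.
move=> [[T1lin T2lin] LE [dom1 dom2] orth [reg sing]].
have ex f : exists g : K * K, [/\ T1 (A f, g.1), T2 (A f, g.2) & B f = g.1 + g.2].
  have : L B (A f, B f) by exists f.
  by rewrite LE => -[g1 [g2 [Tg1 Tg2 Bf]]]; exists (g1, g2).
have [G GP] := choice ex.
have uniq x y z w g1 g2 g1' g2' : T1 (x, g1) -> T2 (y, g2) -> T1 (z, g1') -> T2 (w, g2') ->
    g1 + g2 = g1' + g2' -> g1 = g1' /\ g2 = g2'.
  move=> t1 t2 t1' t2' eqg.
  have g1E : g1 - g1' = g2' - g2.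
    by apply/eqP; rewrite subr_eq addrAC [g2' + _]addrC -eqg addrK.
  have z0 : g1 - g1' = 0.
    apply: inner_eq0; rewrite {2}g1E; apply: orth.
      by exists (x - z); exact: (subspaceB T1lin t1 t1').
    by exists (w - y); exact: (subspaceB T2lin t2' t2).
  by split; apply/eqP; [rewrite -subr_eq0 z0|rewrite eq_sym -subr_eq0 -g1E z0].
pose B1 f := (G f).1; pose B2 f := (G f).2.
have BE f : B f = B1 f + B2 f by have [] := GP f.
have T1B f : T1 (A f, B1 f) by have [] := GP f.
have T2B f : T2 (A f, B2 f) by have [] := GP f.
have lin a u v : B1 (a *: u + v) = a *: B1 u + B1 v /\ B2 (a *: u + v) = a *: B2 u + B2 v.
  apply: (uniq _ _ _ _ _ _ _ _ (T1B _) (T2B _) (T1lin.2 a _ _ (T1B u) (T1B v))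
     (T2lin.2 a _ _ (T2B u) (T2B v))).
  by rewrite -BE Blin !BE scalerDr addrACA.
have B1lin : linear B1 by move=> a u v; have [] := lin a u v.
have B2lin : linear B2 by move=> a u v; have [] := lin a u v.
have sumL x g1 g2 : T1 (x, g1) -> T2 (x, g2) -> exists f, [/\ A f = x, B1 f = g1 & B2 f = g2].
  move=> t1 t2; have : L B (x, g1 + g2) by rewrite LE; exists g1, g2.
  move=> [f _ [fx fg]]; exists f; rewrite BE in fg.
  by have [-> ->] := uniq _ _ _ _ _ _ _ _ (T1B f) (T2B f) t1 t2 fg.
have T1E : T1 = L B1.
  rewrite eqEsubset; split=> [[x g1] t1|_ [f _ <-] //].
  have : T2.`1 x by rewrite dom2 -dom1; exists g1.
  by move=> [g2 t2]; have [f [<- <- _]] := sumL _ _ _ t1 t2; exists f.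
have T2E : T2 = L B2.
  rewrite eqEsubset; split=> [[x g2] t2|_ [f _ <-] //].
  have : T1.`1 x by rewrite dom1 -dom2; exists g2.
  by move=> [g1 t1]; have [f [<- _ <-]] := sumL _ _ _ t1 t2; exists f.
have orthB f g : inner (B1 f) (B2 g) = 0.
  by apply: orth; [exists (A f)|exists (A g)].
exists B1, B2; split=> //; apply/(lebesgue_typeP B Abd); split.
- exact: (bounded_summands Bbd).
- exact/funext.
- by move=> _ _ [f _ <-] [g _ <-]; exact: orthB.
- by apply: closure_operator_densely_defined => //; rewrite -T1E.
- by apply: rel_singular_adjoint_vanishes => //; rewrite -T2E.
Qed.

Lemma unique_lebesgue_rel :
  (exists! p : (E -> K) * (E -> K), lebesgue_type A B p.1 p.2) <->
  (exists! p : set (H * K) * set (H * K), rel_lebesgue_type (L B) p.1 p.2).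
Proof.
split=> [[[B1 B2] /= [leb uniq]]|[[T1 T2] /= [leb uniq]]].
  exists (L B1, L B2); split; first exact: lebesgue_type_rel.
  move=> [T1 T2] /= /rel_lebesgue_type_operators[C1 [C2 [lebC -> ->]]].
  by have [-> ->] := uniq (C1, C2) lebC.
have [B1 [B2 [lebB T1E T2E]]] := rel_lebesgue_type_operators leb.
exists (B1, B2); split=> // -[C1 C2] /= lebC.
have := uniq (L C1, L C2) (lebesgue_type_rel lebC).
rewrite /= in T1E T2E *; rewrite T1E T2E => -[E1 E2].
have C1E : B1 = C1 := pair_relation_inj (lebesgue_type_operator lebB) E1.
rewrite -C1E in lebC *; congr (_, _).
have [_ BE _ _ _] := lebB; have [_ BE' _ _ _] := lebC.
apply/funext => f; have := congr1 (@^~ f) BE; have := congr1 (@^~ f) BE'.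
by rewrite /= => -> /addrI.
Qed.

(** A point of the closure of D(A,B) outside D(A,B) would give a decomposition
    besides the canonical one, by [ando_decomposition]. *)
Lemma unique_lebesgue_closed :
  (exists! p : (E -> K) * (E -> K), lebesgue_type A B p.1 p.2) ->
  closed (pair_domain A B).
Proof.
move=> [p [_ uniq]].
apply/(orthocompl_double_closed (pair_domain_subspace Abd Bbd)) => x xDD.
apply: contrapT => /(ando_decomposition Abd Bbd xDD)[B1 [B2 [leb]]]; apply.
have := uniq (reg_part A B, sing_part A B) (lebesgue_decomposition Abd Bbd).
by have -> := uniq (B1, B2) leb; case.
Qed.

Lemma closed_dominated : closed (pair_domain A B) -> dominated A (reg_part A B).
Proof.
have Dlin := pair_domain_subspace Abd Bbd.
move=> /(orthocompl_double_closed Dlin) Dcl.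
have [rlin _] := reg_sing_part_linear Abd Bbd.
apply: weakly_dominated_dominated => // x.
have [a aD xa] := orthocompl_decomposition x Dlin.
have /(pair_domainP _ Abd Bbd)[h adj] := Dcl _ xa.
exists `|h| => f; rewrite -[x](subrK a) innerDl.
rewrite [inner a _](reg_part_in Abd Bbd f)// addr0 innerC norm_conjC.
by rewrite (inner_reg_part Abd Bbd)// adj mulrC norm_inner.
Qed.

Lemma dominated_closed : dominated A (reg_part A B) -> closed (pair_domain A B).
Proof.
move=> [c _ regA]; have Dlin := pair_domain_subspace Abd Bbd.
apply/(orthocompl_double_closed Dlin) => x xDD.
have [rlin _] := reg_sing_part_linear Abd Bbd.
have [h hP] : exists h, forall f, inner (reg_part A B f) x = inner (A f) h.
  apply: (functional_factor (c := c * `|x|)) => //.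
    by move=> a u v; rewrite rlin innerDl innerZl.
  by move=> f; apply: (le_trans (norm_inner _ _)); rewrite mulrAC ler_wpM2r.
by apply/(pair_domainP _ Abd Bbd); exists h => f; rewrite -(inner_reg_part Abd Bbd).
Qed.

Lemma dominated_closure_bounded (C : E -> K) : dominated A C -> is_bounded (closure (L C)).
Proof.
move=> [c c0 CA]; exists c => h g /closure_pairP cl.
apply/ler_addgt0Pr => e e0.
have c10 : 0 < c + 1 by rewrite addr_gt0.
have ec0 := divr_gt0 e0 c10.
have [_ [f _ <-] /= [/ltW hf /ltW gf]] := cl _ ec0.
have -> : g = (g - C f) + C f by rewrite subrK.
have -> : c * `|h| + e = e / (c + 1) + (c * `|h| + c * (e / (c + 1))).
  by field; rewrite gt_eqF.
apply: (le_trans (ler_normD _ _)); apply: lerD => //.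
apply: (le_trans (CA f)); rewrite -mulrDr ler_pM2l//.
have -> : A f = h - (h - A f) by rewrite opprB addrC subrK.
by apply: (le_trans (ler_normB _ _)); rewrite lerD2l.
Qed.

End RelationDecompositions.

Theorem corollary8p6 (R : realType) (E H K : hilbertType R)
    (A : E -> H) (B : E -> K)
    (hA : bounded_operator A) (hB : bounded_operator B) :
  [<-> exists! p : (E -> K) * (E -> K), lebesgue_type A B p.1 p.2;
       exists! p : set (H * K) * set (H * K),
         rel_lebesgue_type (pair_relation A B) p.1 p.2;
       closed (pair_domain A B);
       dominated A (reg_part A B);
       is_operator (radon_nikodym A (reg_part A B)) /\
       is_bounded (radon_nikodym A (reg_part A B))] /\
  ((exists! p : (E -> K) * (E -> K), lebesgue_type A B p.1 p.2) ->
   forall B1 B2 : E -> K,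
     lebesgue_type A B B1 B2 <->
     B1 = reg_part A B /\ B2 = sing_part A B).
Proof.
have leb := lebesgue_decomposition hA hB.
split; first tfae.
- exact: (unique_lebesgue_rel hA hB).1.
- by move=> /(unique_lebesgue_rel hA hB).2; exact: unique_lebesgue_closed.
- exact: closed_dominated.
- move=> dom; split; last exact: dominated_closure_bounded.
  exact: (lebesgue_type_operator hA leb).
- move=> [_ [c bnd]].
  have /(dominated_closed hA hB) Dcl : dominated A (reg_part A B).
    by apply: (dominated_of_bound (c := c)) => f; apply: bnd; apply: subset_closure; exists f.
  exists (reg_part A B, sing_part A B); split=> // -[B1 B2] /=.
  by move=> /(closed_lebesgue_unique hA hB Dcl)[-> ->].
- move=> /(unique_lebesgue_closed hA hB) Dcl B1 B2; split.
    exact: closed_lebesgue_unique.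
  by move=> [-> ->].
Qed.
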